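(* The process $\{W_\sigma(t)\}_{t\in\mathbb R}$ is continuous in the $\|\cdot\|_{\mathcal W}$ norm (i.e. $t\mapsto W_\sigma(t)$ is continuous from $\mathbb R$ to $\mathcal W$). It is furthermore stationary and of constant variance, $$E[|W_\sigma(t)|^2]=1\quad\text{for all }t\in\mathbb R.$$
   Context: $\sigma$ is a Borel probability measure on $\mathbb R$, symmetric under $u\mapsto-u$, supported in $[-1/2,1/2]$, and there are distinct numbers $\lambda_0=0,\lambda_1,\lambda_2,\ldots$ in $\pi\mathbb N_0$ such that the functions $e_{\lambda_n}(u)=e^{i\lambda_n u}$, $n\ge0$, form an orthonormal basis of $\mathbf L_2(d\sigma)$. Its Fourier transform is $\widehat\sigma(t)=\int_{\mathbb R}e^{itu}\,d\sigma(u)$. White noise space: let $\mathcal S$ be the real Schwartz space on $\mathbb R$, $\Omega=\mathcal S'$ with its Borel $\sigma$-algebra, $P$ the probability measure on $\Omega$ with $\int_\Omega e^{-i\langle\omega,s\rangle}dP(\omega)=e^{-\|s\|^2_{\mathbf L_2(\mathbb R,dx)}/2}$ for $s\in\mathcal S$, and $\mathcal W=\mathbf L_2(\Omega,P)$; $E$ is expectation with respect to $P$. The map $s\mapsto\widetilde s$, $\widetilde s(\omega)=\langle\omega,s\rangle$, extends to an isometry $f\mapsto\widetilde f$ from real $\mathbf L_2(\mathbb R,dx)$ into $\mathcal W$. With $h_0,h_1,\ldots$ the Hermite functions (orthonormal basis of $\mathbf L_2(\mathbb R,dx)$), $Z_n=\widetilde{h_n}$ are i.i.d. $\mathcal N(0,1)$.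 The process $W_\sigma$, which is the derivative in $\mathcal W$ of $X_\sigma(t)=\sum_{n\ge0}\bigl(\int_0^t\widehat\sigma(y-\lambda_n)dy\bigr)Z_n$, is the zero mean Gaussian process $W_\sigma(t)=\sum_{n=0}^\infty\widehat\sigma(t-\lambda_n)Z_n$, the series converging in $\mathcal W$. *)

(* Defs.v *)
From HB Require Import structures.
From mathcomp Require Import all_boot all_order all_algebra.
From mathcomp Require Import complex.
From mathcomp Require Import all_classical all_reals all_analysis.
From mathcomp Require Import ring lra.

Set Implicit Arguments.
Unset Strict Implicit.
Unset Printing Implicit Defensive.
Import Order.TTheory GRing.Theory Num.Theory.
Import numFieldNormedType.Exports.

Local Open Scope classical_set_scope.
Local Open Scope ring_scope.

(* Complex-valued functions on a measure space: R[i] carries no measurable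
   structure or integral in the libraries, so both are taken componentwise. *)
Section complex_L2.
Context {d : measure_display} {T : measurableType d} {R : realType}.
Variable mu : {measure set T -> \bar R}.
Implicit Types f g : T -> R[i].

Definition Cintegral f : R[i] :=
  Complex (\int[mu]_x complex.Re (f x)) (\int[mu]_x complex.Im (f x)).

Definition L2norm f : \bar R :=
  Lnorm mu 2%:E (fun x => (Normc.normc (f x))%:E).

Definition in_L2 f : Prop :=
  [/\ measurable_fun setT (fun x => complex.Re (f x)),
      measurable_fun setT (fun x => complex.Im (f x)) &
      (L2norm f < +oo)%E].

Definition L2_inner f g : R[i] := Cintegral (fun x => f x * conjc (g x)).

Definition L2_sum (u : nat -> T -> R[i]) (f : T -> R[i]) : Prop :=
  in_L2 f /\
  L2norm (fun x => (\sum_(n < N) u n x) - f x) @[N --> \oo] --> 0%E.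

(* The last clause says that the linear span of the e n is dense in L2. *)
Definition L2_orthonormal_basis (e : nat -> T -> R[i]) : Prop :=
  [/\ forall n, in_L2 (e n),
      forall m n, L2_inner (e m) (e n) = (m == n)%:R &
      forall f, in_L2 f -> forall eps : R, 0 < eps ->
        exists N (c : 'I_N -> R[i]),
          (L2norm (fun x => (f x - \sum_(n < N) c n * e n x)%R) < eps%:E)%E].

End complex_L2.

Section processes.
Context {d : measure_display} {T : measurableType d} {R : realType}.
Variable P : {measure set T -> \bar R}.

Definition L2_continuous (W : R -> T -> R[i]) : Prop :=
  forall t, L2norm P (fun w => W s w - W t w) @[s --> t] --> 0%E.

(* (W (t_1), ..., W (t_k)) as a random element of C^k = (R * R)^k. *)
Definition marginal (W : R -> T -> R[i]) k (t : k.-tuple R) (w : T) :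
    k.-tuple (measurableTypeR R * measurableTypeR R)%type :=
  [tuple (complex.Re (W (tnth t i) w), complex.Im (W (tnth t i) w)) | i < k].

(* All finite-dimensional distributions are invariant under time shifts. *)
Definition stationary (W : R -> T -> R[i]) : Prop :=
  forall k (t : k.-tuple R) (h : R)
         (A : set (k.-tuple (measurableTypeR R * measurableTypeR R)%type)),
    measurable A ->
    P (marginal W [tuple tnth t i + h | i < k] @^-1` A) =
    P (marginal W t @^-1` A).

End processes.

Section fourier.
Context {R : realType}.

Definition expi (x : R) : R[i] := Complex (cos x) (sin x).

Definition fourier (sigma : {measure set (measurableTypeR R) -> \bar R})
    (t : R) : R[i] :=
  Cintegral sigma (fun u => expi (t * u)).

End fourier.

Section schwartz.
Context {R : realType}.

Definition schwartz (f : R -> R) : Prop :=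
  (forall n x, derivable (derive1n n f) x 1) /\
  (forall m n : nat, exists C : R, forall x, `|x ^+ m * derive1n n f x| <= C).

Definition Schwartz_pred : {pred R -> R} := mem [set f | schwartz f].

Lemma Schwartz_predP f : reflect (schwartz f) (f \in Schwartz_pred).
Proof. by apply: (iffP idP); rewrite inE. Qed.

Lemma derive1n_lin (a : R) (f g : R -> R) :
  (forall n x, derivable (derive1n n f) x 1) ->
  (forall n x, derivable (derive1n n g) x 1) ->
  forall n, derive1n n (a *: f + g) = a *: derive1n n f + derive1n n g.
Proof.
move=> df dg; elim=> [//|n IH].
rewrite !derive1nS IH; apply/funext => x.
rewrite derive1E deriveD; [|exact: derivableZ|exact: dg].
rewrite deriveZ; [|exact: df].
by rewrite /= -!derive1E.
Qed.

Lemma schwartz_submod_closed : submod_closed Schwartz_pred.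
Proof.
split.
  apply/Schwartz_predP.
  have d0 n : derive1n n (0 : R -> R) = 0.
    elim: n => [//|n IH]; rewrite derive1nS IH; apply/funext => x.
    exact: derive1_cst.
  split=> [n x|m n]; first by rewrite d0; exact: derivable_cst.
  by exists 0 => x; rewrite d0 mulr0 normr0.
move=> a f g /Schwartz_predP[df bf] /Schwartz_predP[dg bg].
apply/Schwartz_predP; split=> [n x|m n].
  rewrite derive1n_lin//; apply: derivableD; last exact: dg.
  by apply: derivableZ; exact: df.
have [Cf Hf] := bf m n; have [Cg Hg] := bg m n.
exists (`|a| * Cf + Cg) => x; rewrite derive1n_lin//=.
have -> : x ^+ m * ((a *: derive1n n f + derive1n n g) x) =
          a * (x ^+ m * derive1n n f x) + x ^+ m * derive1n n g x.
  by rewrite -[(_ + _) x]/(a * derive1n n f x + derive1n n g x); ring.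
rewrite (le_trans (ler_normD _ _))// lerD//.
by rewrite normrM ler_wpM2l.
Qed.

HB.instance Definition _ :=
  GRing.isSubmodClosed.Build R (R -> R) Schwartz_pred schwartz_submod_closed.

End schwartz.

Section hermite.
Context {R : realType}.

Definition gaussM (c : R) (p : {poly R}) (x : R) : R :=
  p.[x] * expR (- (c * x ^+ 2)).

Lemma is_derive_gaussM (c : R) (p : {poly R}) (x : R) :
  is_derive x (1 : R) (gaussM c p) (gaussM c (p^`() - (c *+ 2) *: 'X * p) x).
Proof.
have de : is_derive x (1 : R) (fun y : R => expR (- (c * y ^+ 2)))
    (- (c * (x *+ 2)) * expR (- (c * x ^+ 2))).
  have dq : is_derive x (1 : R) (fun y : R => - (c * y ^+ 2)) (- (c * (x *+ 2))).
    apply: is_deriveN; apply: is_derive_eq.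
    by rewrite /GRing.scale/=; ring.
  rewrite mulrC.
  exact: (@is_derive1_comp _ expR (fun y : R => - (c * y ^+ 2)) x _ _
            (is_derive_expR _) dq).
rewrite /gaussM; apply: is_derive_eq.
rewrite !hornerE /GRing.scale/=; ring.
Qed.

Lemma gaussM_deriven (c : R) (p : {poly R}) n :
  exists q, derive1n n (gaussM c p) = gaussM c q.
Proof.
elim: n => [|n [q IH]]; first by exists p.
exists (q^`() - (c *+ 2) *: 'X * q); rewrite derive1nS IH.
by apply/funext => x; rewrite derive1E; have [_ ->] := is_derive_gaussM c q x.
Qed.

Lemma expR_monomial_le (c : R) k : 0 < c ->
  exists C : R, forall y, 0 <= y -> y ^+ k * expR (- (c * y)) <= C.
Proof.
move=> c0; exists (k`!%:R / c ^+ k) => y y0.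
rewrite expRN ler_pdivrMr ?expR_gt0//.
have cy0 : 0 <= c * y by rewrite mulr_ge0// ltW.
have H : (c * y) ^+ k / k`!%:R <= expR (c * y).
  case: k => [|k].
    by rewrite expr0 fact0 divr1 (le_trans _ (expR_ge1Dx _))// lerDl.
  by rewrite (le_trans _ (expR_ge1Dxn k cy0))// lerDr.
have ck0 : 0 < c ^+ k by rewrite exprn_gt0.
have k0 : 0 < k`!%:R :> R by rewrite ltr0n fact_gt0.
apply: le_trans (ler_wpM2l _ H); last by rewrite ltW// divr_gt0.
by rewrite exprMn; rewrite le_eqVlt; apply/orP; left; apply/eqP; field; rewrite !gt_eqF.
Qed.

Lemma monomial_bounded (c : R) k : 0 < c ->
  exists C : R, forall x, `|x ^+ k * expR (- (c * x ^+ 2))| <= C.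
Proof.
move=> c0; have [C HC] := expR_monomial_le k c0.
exists (1 + C) => x; have x20 : 0 <= x ^+ 2 by rewrite sqr_ge0.
rewrite normrM (ger0_norm (expR_ge0 _)).
have e1 : expR (- (c * x ^+ 2)) <= 1.
  by rewrite -expR0 ler_expR oppr_le0 mulr_ge0// ltW.
have : `|x ^+ k| <= 1 + (x ^+ 2) ^+ k.
  rewrite -exprM mulnC exprM normrX -[x ^+ k ^+ 2]real_normK ?num_real//.
  by rewrite normrX; nra.
move=> /(ler_wpM2r (expR_ge0 (- (c * x ^+ 2)))) /le_trans; apply.
by rewrite mulrDl mul1r lerD// HC.
Qed.

Lemma gaussM_bounded (c : R) (p : {poly R}) : 0 < c ->
  exists C : R, forall x, `|gaussM c p x| <= C.
Proof.
move=> c0.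
have /choice[C HC] : forall k, exists C : R,
    forall x, `|x ^+ k * expR (- (c * x ^+ 2))| <= C.
  by move=> k; exact: monomial_bounded.
exists (\sum_(i < size p) `|p`_i| * C i) => x.
rewrite /gaussM horner_coef mulr_suml (le_trans (ler_norm_sum _ _ _))//.
by apply: ler_sum => i _; rewrite -mulrA normrM ler_wpM2l.
Qed.

Lemma schwartz_gaussM (c : R) (p : {poly R}) : 0 < c -> schwartz (gaussM c p).
Proof.
move=> c0; split=> [n x|m n].
  have [q ->] := gaussM_deriven c p n.
  by have [] := is_derive_gaussM c q x.
have [q ->] := gaussM_deriven c p n.
have [C HC] := gaussM_bounded ('X^m * q) c0.
exists C => x; rewrite (le_trans _ (HC x))// le_eqVlt; apply/orP; left.
by rewrite /gaussM hornerM hornerXn mulrA.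
Qed.

(* Rodrigues' formula; gauss_fun x = exp (- x ^ 2). *)
Definition hermite_fun (n : nat) (x : R) : R :=
  (-1) ^+ n / Num.sqrt (2 ^+ n * n`!%:R * Num.sqrt pi) *
  expR (x ^+ 2 / 2) * derive1n n gauss_fun x.

Lemma schwartz_hermite n : schwartz (hermite_fun n).
Proof.
have gE : @gauss_fun R = gaussM 1 1.
  by apply/funext => x; rewrite /gaussM hornerE !mul1r.
have [q qE] := gaussM_deriven 1 1 n.
have h0 : 0 < (2^-1 : R) by rewrite invr_gt0.
rewrite (_ : hermite_fun n = gaussM 2^-1
  (((-1) ^+ n / Num.sqrt (2 ^+ n * n`!%:R * Num.sqrt pi)) *: q)).
  exact: schwartz_gaussM.
apply/funext => x; rewrite /hermite_fun gE qE /gaussM hornerZ.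
rewrite -!mulrA; congr (_ * (_ * _)); rewrite mulrCA; congr (_ * _).
by rewrite -expRD; congr expR; field.
Qed.

End hermite.

Definition Schwartz (R : realType) := {f : R -> R | f \in Schwartz_pred}.

HB.instance Definition _ (R : realType) := SubChoice.on (Schwartz R).
HB.instance Definition _ (R : realType) :=
  [SubChoice_isSubLmodule of Schwartz R by <:].

Definition Schwartz_fun (R : realType) (s : Schwartz R) : R -> R := val s.
Coercion Schwartz_fun : Schwartz >-> Funclass.

(* The Schwartz topology: s converges iff, for all m and n, the functions
   x ^ m * s^(n)(x) converge uniformly on R. *)
Definition Schwartz_embedding (R : realType) (s : Schwartz R) :
    {ptws (nat * nat) -> {uniform R -> R}} :=
  fun mn x => x ^+ mn.1 * derive1n mn.2 s x.

HB.instance Definition _ (R : realType) :=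
  Topological.copy (Schwartz R) (initial_topology (@Schwartz_embedding R)).

Definition tempered (R : realType) :=
  {w : {linear Schwartz R -> R^o} | continuous (w : Schwartz R -> R)}.

Definition pairing (R : realType) (w : tempered R) (s : Schwartz R) : R :=
  sval w s.

HB.instance Definition _ (R : realType) := gen_eqMixin (tempered R).
HB.instance Definition _ (R : realType) := gen_choiceMixin (tempered R).

Lemma continuous_null (R : realType) :
  continuous ((\0 : {linear Schwartz R -> R^o}) : Schwartz R -> R).
Proof. by move=> s; exact: cst_continuous. Qed.

Definition tempered0 (R : realType) : tempered R :=
  exist _ (\0 : {linear Schwartz R -> R^o}) (@continuous_null R).

HB.instance Definition _ (R : realType) :=
  isPointed.Build (tempered R) (tempered0 R).

(* The weak-* topology; Omega below carries its Borel sigma-algebra. *)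
HB.instance Definition _ (R : realType) :=
  Topological.copy (tempered R)
    (initial_topology (@pairing R : tempered R -> {ptws Schwartz R -> R})).

Definition Omega (R : realType) :=
  g_sigma_algebraType (@open (tempered R)).

Definition is_white_noise (R : realType) (P : probability (Omega R) R) : Prop :=
  forall s : Schwartz R,
    Cintegral P (fun w => expi (- pairing w s)) =
    Complex (expR (- (\int[lebesgue_measure]_x (s x ^+ 2)) / 2)) 0.

Definition hermite (R : realType) (n : nat) : Schwartz R :=
  exist _ (@hermite_fun R n) (introT (Schwartz_predP _) (schwartz_hermite n)).

(* Since hermite n is a Schwartz function, the image of the n-th Hermite
   function under the isometric extension of s |-> <w, s> is <w, hermite n>. *)
Definition hermite_rv (R : realType) (n : nat) (w : Omega R) : R :=
  pairing w (hermite R n).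

(* Elements of L2(P) are handled through representatives: each W t is any
   representative of the sum of the series in L2(P). *)
Definition is_W_process (R : realType) (P : probability (Omega R) R)
    (sigma : probability (measurableTypeR R) R) (lambda : nat -> R)
    (W : R -> Omega R -> R[i]) : Prop :=
  forall t, L2_sum P
    (fun n w => fourier sigma (t - lambda n) * Complex (hermite_rv n w) 0) (W t).

(* Main.v *)
Require Import Defs.
From mathcomp Require Import all_boot all_order all_algebra.
From mathcomp Require Import complex.
From mathcomp Require Import all_classical all_reals all_analysis.
From mathcomp Require Import measurable_realfun ring lra.
Import Order.TTheory GRing.Theory Num.Theory.
Import numFieldNormedType.Exports.

(** Write [K(s) = \int cos(s u) dsigma(u)].  By the symmetry of [sigma] the
    Fourier transform of [sigma] is the real function [K], so that each partial
    sum of [W(t)] is a finite real combination of the [Z_n].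

    The proof computes the joint characteristic function of the values of [W].
    The Hermite functions are orthonormal ([hermite_fun_orthonormal]), hence the
    defining formula of white noise gives
    [E cos(\sum_{n<N} c_n Z_n) = exp(- \sum_{n<N} c_n^2 / 2)]
    ([characteristic_hermite_sum]).  For a trigonometric sum
    [f(u) = \sum_j a_j e^{i t_j u}] the partial sums of [\sum_j a_j W(t_j)] have
    the coefficients [c_n = \sum_j a_j K(t_j - lambda_n)], which are the Fourier
    coefficients of [f] in the basis of the [e_{lambda_n}].  Parseval's identity
    ([cvg_spectral_coef]) says that [\sum_n c_n^2] is the squared norm of [f] in
    [L2(sigma)], that is [\sum_{j,k} a_j a_k K(t_j - t_k)].  Passing to the
    limit in [L2(P)], [\sum_j a_j W(t_j)] has the characteristic function of a
    centered Gaussian variable with this variance ([characteristic_W]).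

    The three claims follow.  The variance of a variable with a Gaussian
    characteristic function can be read off at the origin
    ([second_moment_of_characteristic]), whence [E|W(t)|^2 = K(0) = 1] and
    [E|W(s) - W(t)|^2 = 2 (1 - K(s - t))], which is at most [2 (s - t)^2] since
    [sigma] lives on [[-1/2, 1/2]].  The covariance only depends on the
    differences of the times, so the characteristic functions of
    [(W(t_1), ..., W(t_k))] and of its translates agree, and a finite
    dimensional law is determined by its characteristic function
    ([equal_characteristic_equal_law]). *)

Set Implicit Arguments.
Unset Strict Implicit.
Unset Printing Implicit Defensive.

Local Open Scope classical_set_scope.
Local Open Scope ring_scope.

(** * Integrals of real-valued functions *)

Section real_integrable.
Context {R : realType} d (T : measurableType d) (mu : {measure set T -> \bar R}).
Implicit Types (f g : T -> R) (c : R).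

Lemma EFin_integrableD f g : mu.-integrable setT (EFin \o f) ->
  mu.-integrable setT (EFin \o g) ->
  mu.-integrable setT (EFin \o fun x => f x + g x).
Proof. by move=> If Ig; have := integrableD measurableT If Ig; exact: eq_integrable. Qed.

Lemma EFin_integrableZ c f : mu.-integrable setT (EFin \o f) ->
  mu.-integrable setT (EFin \o fun x => c * f x).
Proof. by move=> If; have := integrableZl measurableT c If; exact: eq_integrable. Qed.

Lemma EFin_integrableB f g : mu.-integrable setT (EFin \o f) ->
  mu.-integrable setT (EFin \o g) ->
  mu.-integrable setT (EFin \o fun x => f x - g x).
Proof. by move=> If Ig; have := integrableB measurableT If Ig; exact: eq_integrable. Qed.

Lemma EFin_integrable_sum (I : Type) (s : seq I) (h : I -> T -> R) :
  (forall i, mu.-integrable setT (EFin \o h i)) ->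
  mu.-integrable setT (EFin \o fun x => \sum_(i <- s) h i x).
Proof.
move=> Ih; elim: s => [|i s IH].
  rewrite (_ : EFin \o _ = cst 0%E); first exact: integrable0.
  by apply/funext => x /=; rewrite big_nil.
have := EFin_integrableD (Ih i) IH; apply: eq_integrable => // x _ /=.
by rewrite big_cons.
Qed.

Lemma Rintegral_sum (I : Type) (s : seq I) (h : I -> T -> R) :
  (forall i, mu.-integrable setT (EFin \o h i)) ->
  \int[mu]_x (\sum_(i <- s) h i x) = \sum_(i <- s) \int[mu]_x h i x.
Proof.
move=> Ih; elim: s => [|i s IH].
  rewrite big_nil -[RHS](@Rintegral_set0 _ _ _ mu (cst 0)) /Rintegral integral_set0.
  by rewrite (eq_integral (cst 0%E)) ?integral0// => x _; rewrite big_nil.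
rewrite big_cons -IH -RintegralD//; last exact: EFin_integrable_sum.
by apply: eq_Rintegral => x _; rewrite big_cons.
Qed.

End real_integrable.

Section bounded_functions.
Context {R : realType} d (T : measurableType d) (P : probability T R).
Implicit Types (f g : T -> R) (C : R).

Lemma bounded_integrable f C : measurable_fun setT f ->
  (forall x, `|f x| <= C) -> P.-integrable setT (EFin \o f).
Proof.
move=> mf fC; apply: measurable_bounded_integrable => //.
  by rewrite -ge0_fin_numE// fin_num_measure.
exists C; split; first exact: num_real.
by move=> M CM x _; exact: le_trans (fC x) (ltW CM).
Qed.

Lemma Rintegral_probability_cst C : \int[P]_x C = C.
Proof.
rewrite Rintegral_cst// -[RHS]mulr1; congr (_ * _).
by transitivity (fine (1%:E : \bar R)); first by congr fine; exact: probability_setT.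
Qed.

Lemma bounded_cvg_Rintegral (f_ : nat -> T -> R) f C :
  (forall n, measurable_fun setT (f_ n)) ->
  (forall n x, `|f_ n x| <= C) -> (forall x, f_ n x @[n --> \oo] --> f x) ->
  \int[P]_x f_ n x @[n --> \oo] --> \int[P]_x f x.
Proof.
move=> mf_ fC f_f; have mf : measurable_fun setT f.
  by apply: (measurable_realfun.measurable_fun_cvg mf_) => x _; exact: f_f.
have Cf x : `|f x| <= C.
  have h : `|f_ n x| @[n --> \oo] --> `|f x| by apply: cvg_norm; exact: f_f.
  rewrite -(cvg_lim _ h)//; apply: limr_le; last by apply: nearW => n; exact: fC.
  by apply/cvg_ex; exists `|f x|.
have intf := bounded_integrable mf Cf.
have [|||||_ _] := @dominated_convergence _ T R P setT measurableT
   (fun n => EFin \o f_ n) (EFin \o f) (EFin \o cst C).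
- by move=> n; apply/measurable_EFinP.
- exact/measurable_EFinP.
- by apply: aeW => x _; apply/fine_cvgP; split; [exact: nearW|exact: f_f].
- apply: (@bounded_integrable _ `|C|) => //.
- by apply: aeW => x n _ /=; rewrite lee_fin.
move=> h; apply: fine_cvg; rewrite /Rintegral fineK //.
exact: integrable_fin_num.
Qed.

End bounded_functions.

(** * Characteristic functions determine finite-dimensional laws *)

Section sign_polynomials.
Context {R : realType}.

(** Iterates of [s |-> s (3 - s^2) / 2], whose attracting fixed points are [1]
    and [-1]: they are polynomials, bounded by [1] on [[-1, 1]], and converge
    pointwise there to the sign function. *)
Fixpoint smoothstep (n : nat) : {poly R} :=
  if n is n'.+1 then 2^-1 *: (smoothstep n' * (3%:P - smoothstep n' ^+ 2))
  else 'X.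

Lemma smoothstepS n (s : R) : (smoothstep n.+1).[s] =
  2^-1 * ((smoothstep n).[s] * (3 - (smoothstep n).[s] ^+ 2)).
Proof. by rewrite /= !hornerE. Qed.

Lemma smoothstepN n (s : R) : (smoothstep n).[- s] = - (smoothstep n).[s].
Proof.
elim: n => [|n IH]; first by rewrite !hornerE.
by rewrite !smoothstepS IH; ring.
Qed.

Lemma smoothstep_itv n (s : R) : 0 <= s <= 1 -> s <= (smoothstep n).[s] <= 1.
Proof.
move=> /andP[s0 s1]; elim: n => [|n]; first by rewrite !hornerE lexx.
rewrite smoothstepS; set p := (smoothstep n).[s] => /andP[sp p1].
have p0 : 0 <= p by exact: le_trans sp.
have h1 : 0 <= p * (1 - p) * (1 + p) by rewrite !mulr_ge0//; lra.
have h2 : 0 <= (1 - p) ^+ 2 * (2 + p) by rewrite mulr_ge0 ?sqr_ge0//; lra.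
by apply/andP; split; lra.
Qed.

Lemma smoothstep_norm n (s : R) : `|s| <= 1 -> `|(smoothstep n).[s]| <= 1.
Proof.
have [s0|s0] := leP 0 s => s1.
  have /(smoothstep_itv n)/andP[h1 h2] : 0 <= s <= 1.
    by rewrite s0 (le_trans (ler_norm _)).
  by rewrite ger0_norm// (le_trans s0).
have sN0 : 0 <= - s by rewrite oppr_ge0 ltW.
have /(smoothstep_itv n)/andP[] : 0 <= - s <= 1.
  by rewrite sN0 (le_trans (ler_norm _))// normrN.
rewrite smoothstepN => h1 h2.
by rewrite -normrN ger0_norm// (le_trans sN0).
Qed.

Lemma cvg_smoothstep_gt0 (s : R) : 0 < s <= 1 ->
  (smoothstep n).[s] @[n --> \oo] --> (1 : R).
Proof.
move=> /andP[s0 s1]; have s01 : 0 <= s <= 1 by rewrite ltW.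
have h n : 1 - (1 - s / 2) ^+ n <= (smoothstep n).[s] <= 1.
  rewrite (andP (smoothstep_itv n s01)).2 andbT.
  (* 1 - p (3 - p^2) / 2 = (1 - p)^2 (2 + p) / 2, which is at most
     (1 - p) (1 - s / 2) for s <= p <= 1. *)
  elim: n => [|n IH]; first by rewrite !hornerE expr0 subrr ltW.
  rewrite smoothstepS exprS; have := smoothstep_itv n s01.
  move: IH; set p := (smoothstep n).[s]; set e := _ ^+ n => IH /andP[sp p1].
  have : 0 <= (1 - s / 2) by nra.
  move=> q0; have : (1 - p) * (1 - s / 2) <= e * (1 - s / 2) by nra.
  have : (1 - p) * (1 - p) * (2 + p) / 2 <= (1 - p) * (1 - s / 2).
    have : (1 - p) * (2 + p) <= 2 * (1 - s / 2) by nra.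
    by nra.
  by nra.
apply: (@squeeze_cvgr _ _ _ _ (fun n => 1 - (1 - s / 2) ^+ n) (cst 1)).
- exact: nearW.
- rewrite -[X in _ --> X]subr0; apply: cvgB; first exact: cvg_cst.
  by apply: cvg_expr; rewrite ger0_norm; lra.
- exact: cvg_cst.
Qed.

Lemma cvg_smoothstep (s : R) : `|s| <= 1 ->
  (smoothstep n).[s] @[n --> \oo] --> Num.sg s.
Proof.
move=> s1; have [s0|s0|s0] := sgrP s.
- rewrite s0; have -> : (fun n => (smoothstep n).[0 : R]) = cst 0.
    apply/funext => n; elim: n => [|n IH]; first by rewrite hornerX.
    by rewrite smoothstepS IH mul0r mulr0.
  exact: cvg_cst.
- by apply: cvg_smoothstep_gt0; rewrite s0 (le_trans (ler_norm _)).
- rewrite (_ : (fun n => _) = fun n => - (smoothstep n).[- s]).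
    by apply: cvgN; apply: cvg_smoothstep_gt0;
      rewrite oppr_gt0 s0 (le_trans (ler_norm _))// normrN.
  by apply/funext => n; rewrite smoothstepN opprK.
Qed.

End sign_polynomials.

Section equal_laws.
Context {R : realType} d (T : measurableType d) (P : probability T R).
Context d' (U : measurableType d') (I : finType) (pr : I -> U -> R).
Hypothesis mpr : forall i, measurable_fun setT (pr i).
Variables X Y : T -> U.
Hypotheses (mX : measurable_fun setT X) (mY : measurable_fun setT Y).

Definition phase (a : I -> R) (b : R) (u : U) : R :=
  cos (\sum_i a i * pr i u + b).

Lemma measurable_phase a b : measurable_fun setT (phase a b).
Proof.
apply: measurableT_comp; first exact: (continuous_measurable_fun (@continuous_cos R)).
apply: measurable_funD => //; apply: measurable_sum => i.
exact: measurable_funM.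
Qed.

Lemma phase_norm a b u : `|phase a b u| <= 1.
Proof. exact: cos_max. Qed.

(** The weight [phase a b] is carried along so that the functions of this kind
    are stable under multiplication by trigonometric functions of the
    coordinates, and not only under linear combinations and bounded limits. *)
Definition phase_indistinguishable (f : U -> R) : Prop :=
  [/\ measurable_fun setT f, exists C : R, forall u, `|f u| <= C &
      forall a b, \int[P]_w (f (X w) * phase a b (X w)) =
                  \int[P]_w (f (Y w) * phase a b (Y w))].

Let integrableX (f : U -> R) a b (Z : T -> U) : measurable_fun setT Z ->
  measurable_fun setT f -> (exists C : R, forall u, `|f u| <= C) ->
  P.-integrable setT (EFin \o fun w => f (Z w) * phase a b (Z w)).
Proof.
move=> mZ mf [C fC].
apply: (@bounded_integrable _ _ _ _ _ `|C|).
  apply: measurable_funM; first exact: measurableT_comp.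
  by apply: measurableT_comp => //; exact: measurable_phase.
move=> w; rewrite normrM -[leRHS]mulr1 ler_pM//; last exact: phase_norm.
exact: le_trans (ler_norm _).
Qed.

Lemma phase_indistinguishableZD c f g :
  phase_indistinguishable f -> phase_indistinguishable g ->
  phase_indistinguishable (fun u => c * f u + g u).
Proof.
move=> [mf [C fC] ef] [mg [D gD] eg]; split.
- by apply: measurable_funD => //; exact: measurable_funM.
- exists (`|c| * C + D) => u; rewrite (le_trans (ler_normD _ _))//.
  by rewrite normrM lerD// ler_wpM2l.
move=> a b.
have h (Z : T -> U) : measurable_fun setT Z ->
    \int[P]_w ((c * f (Z w) + g (Z w)) * phase a b (Z w)) =
    c * \int[P]_w (f (Z w) * phase a b (Z w)) +
    \int[P]_w (g (Z w) * phase a b (Z w)).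
  move=> mZ.
  have If := integrableX a b mZ mf (ex_intro _ C fC).
  have Ig := integrableX a b mZ mg (ex_intro _ D gD).
  rewrite -RintegralZl// -RintegralD//; last exact: EFin_integrableZ.
  by apply: eq_Rintegral => w _; ring.
by rewrite !h// ef eg.
Qed.

(** A product of two cosines is a half-sum of two cosines. *)
Lemma phase_indistinguishable_phase f a b :
  phase_indistinguishable f ->
  phase_indistinguishable (fun u => f u * phase a b u).
Proof.
move=> [mf [C fC] ef]; split.
- by apply: measurable_funM => //; exact: measurable_phase.
- exists C => u; rewrite normrM -[leRHS]mulr1 ler_pM//; exact: phase_norm.
move=> a' b'.
have h (Z : T -> U) : measurable_fun setT Z ->
    \int[P]_w (f (Z w) * phase a b (Z w) * phase a' b' (Z w)) =
    2^-1 * (\int[P]_w (f (Z w) * phase (fun i => a i + a' i) (b + b') (Z w)) +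
    \int[P]_w (f (Z w) * phase (fun i => a i - a' i) (b - b') (Z w))).
  move=> mZ.
  rewrite -RintegralD//; [|exact: integrableX (ex_intro _ C fC)..].
  rewrite -RintegralZl//; last first.
    by apply: EFin_integrableD; exact: integrableX (ex_intro _ C fC).
  apply: eq_Rintegral => w _; rewrite /phase.
  set x := \sum_i a i * _; set y := \sum_i a' i * _.
  have -> : \sum_i (a i + a' i) * pr i (Z w) = x + y.
    by rewrite -big_split; apply: eq_bigr => i _; rewrite mulrDl.
  have -> : \sum_i (a i - a' i) * pr i (Z w) = x - y.
    by rewrite -sumrB; apply: eq_bigr => i _; rewrite mulrBl.
  rewrite (_ : x + y + (b + b') = (x + b) + (y + b')); last by ring.
  rewrite (_ : x - y + (b - b') = (x + b) - (y + b')); last by ring.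
  by rewrite (cosD (x + b)) (cosB (x + b)); field.
by rewrite !h// !ef.
Qed.

Lemma phase_indistinguishable_lim (f_ : nat -> U -> R) f C :
  (forall n, phase_indistinguishable (f_ n)) ->
  (forall n u, `|f_ n u| <= C) -> (forall u, f_ n u @[n --> \oo] --> f u) ->
  phase_indistinguishable f.
Proof.
move=> If fC f_f; split.
- apply: (measurable_realfun.measurable_fun_cvg (h := f_)) => //.
  by move=> n; have [] := If n.
- exists C => u; have h : `|f_ n u| @[n --> \oo] --> `|f u| by exact: cvg_norm.
  rewrite -(cvg_lim _ h)//; apply: limr_le; last by apply: nearW => n; exact: fC.
  by apply/cvg_ex; exists `|f u|.
move=> a b.
have h (Z : T -> U) : measurable_fun setT Z ->
    \int[P]_w (f_ n (Z w) * phase a b (Z w)) @[n --> \oo] -->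
    \int[P]_w (f (Z w) * phase a b (Z w)).
  move=> mZ; apply: (@bounded_cvg_Rintegral _ _ _ _ _ _ C).
  - move=> n; have [mf _ _] := If n; apply: measurable_funM.
      exact: measurableT_comp.
    by apply: measurableT_comp => //; exact: measurable_phase.
  - move=> n w; rewrite normrM -[leRHS]mulr1 ler_pM//; exact: phase_norm.
  - by move=> w; apply: cvgMl; exact: f_f.
have eXY : (fun n => \int[P]_w (f_ n (X w) * phase a b (X w))) =
          (fun n => \int[P]_w (f_ n (Y w) * phase a b (Y w))).
  by apply/funext => n; have [_ _ ->] := If n.
have := h _ mX; rewrite eXY => hX.
exact: cvg_unique hX (h _ mY).
Qed.

Lemma phase_indistinguishable_sin_poly f i c m (q : {poly R}) :
  phase_indistinguishable f ->
  phase_indistinguishable (fun u => f u * q.[sin ((pr i u - c) / m)]).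
Proof.
move=> If; elim/poly_ind: q => [|q r IH].
  have := phase_indistinguishableZD (-1) If If.
  by congr phase_indistinguishable; apply/funext => u; rewrite hornerC; ring.
have Ip := phase_indistinguishable_phase
  (fun j => if j == i then m^-1 else 0) (- (c / m) - pi / 2) IH.
have := phase_indistinguishableZD r If Ip.
congr phase_indistinguishable; apply/funext => u; rewrite !hornerE /phase.
rewrite (bigD1 i)//= eqxx big1 => [|j /negPf ->]; last by rewrite mul0r.
rewrite addr0 addrA cosBpihalf (_ : m^-1 * _ - _ = (pr i u - c) / m); last by ring.
by ring.
Qed.

Lemma phase_indistinguishable_sg f i c m :
  phase_indistinguishable f ->
  phase_indistinguishable (fun u => f u * Num.sg (sin ((pr i u - c) / m))).
Proof.
move=> If; have [_ [C fC] _] := If.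
apply: (@phase_indistinguishable_lim
  (fun n u => f u * (smoothstep n).[sin ((pr i u - c) / m)]) _ C).
- by move=> n; exact: phase_indistinguishable_sin_poly.
- move=> n u; rewrite normrM -[leRHS]mulr1 ler_pM//.
  exact/smoothstep_norm/sin_max.
- by move=> u; apply: cvgMr; exact/cvg_smoothstep/sin_max.
Qed.

(** [sin((x - c) / m)] has the sign of [x - c] as soon as [m pi > |x - c|], so
    polynomials in the sine reach the indicator of a ray by two successive
    bounded limits. *)
Lemma phase_indistinguishable_ray f i c :
  phase_indistinguishable f ->
  phase_indistinguishable (fun u => f u * \1_[set u | c < pr i u] u).
Proof.
move=> If; have [_ [C fC] _] := If.
suff Is g : phase_indistinguishable g ->
    phase_indistinguishable (fun u => g u * Num.sg (pr i u - c)).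
  (* The indicator of x > 0 is (sg x + sg x ^ 2) / 2; the last summand is 0. *)
  have I1 := Is _ If; have I2 := Is _ I1.
  have := phase_indistinguishableZD 2^-1 I1
    (phase_indistinguishableZD 2^-1 I2 (phase_indistinguishableZD (-1) If If)).
  congr phase_indistinguishable; apply/funext => u; rewrite indicE.
  have -> : (u \in [set u | c < pr i u]) = (0 < pr i u - c).
    by apply/idP/idP; rewrite subr_gt0 inE.
  by case: sgrP => _ /=; field.
move=> {C fC If} Ig; have [_ [C gC] _] := Ig.
apply: (@phase_indistinguishable_lim
  (fun n u => g u * Num.sg (sin ((pr i u - c) / n.+1%:R))) _ C).
- by move=> n; exact: phase_indistinguishable_sg.
- move=> n u; rewrite normrM -[leRHS]mulr1 ler_pM// normr_sg.
  by case: eqP.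
move=> u; apply: cvgMr; apply: cvg_near_cst.
near=> n; set x := pr i u - c.
have npi : `|x / n.+1%:R| < pi.
  rewrite normrM normfV normr_nat ltr_pdivrMr ?ltr0n// mulrC -ltr_pdivrMr ?pi_gt0//.
  rewrite (@le_lt_trans _ _ n%:R)// ?ltr_nat//; near: n; exact: nbhs_infty_ger.
have n0 : 0 < n.+1%:R^-1 :> R by rewrite invr_gt0 ltr0n.
have -> : Num.sg x = Num.sg (x / n.+1%:R) by rewrite sgrM (gtr0_sg n0) mulr1.
move: npi; set y := x / _; case: (sgrP y) => [->|y0|y0] ypi.
- by rewrite sin0 sgr0.
- by rewrite gtr0_sg// sin_gt0_pi// y0.
- by rewrite -[y]opprK sinN sgrN gtr0_sg// sin_gt0_pi// oppr_gt0 y0.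
Unshelve. all: by end_near. Qed.

(** The sets whose indicators can be multiplied into an indistinguishable
    function form a sigma-algebra, so it suffices to treat rays. *)
Lemma phase_indistinguishable_indic A f :
  <<s [set A | exists i c, A = [set u | c < pr i u]] >> A ->
  phase_indistinguishable f -> phase_indistinguishable (fun u => f u * \1_A u).
Proof.
move=> sA; move: f; pose D := [set A : set U | forall f,
  phase_indistinguishable f -> phase_indistinguishable (fun u => f u * \1_A u)].
apply: (smallest_sub (X := D) _ _ sA).
  have DC A' : D A' -> D (~` A').
    move=> DA f If; have := phase_indistinguishableZD (-1) (DA _ If) If.
    congr phase_indistinguishable; apply/funext => u; rewrite !indicE in_setC.
    by case: (u \in A') => /=; ring.
  have D0 : D set0.
    move=> f If; have := phase_indistinguishableZD (-1) If If.
    by congr phase_indistinguishable; apply/funext => u; rewrite indic0 /=; ring.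
  have DI A1 A2 : D A1 -> D A2 -> D (A1 `&` A2).
    move=> D1 D2 f If; have := D2 _ (D1 _ If).
    by congr phase_indistinguishable; apply/funext => u; rewrite indicI /= mulrA.
  have DU A1 A2 : D A1 -> D A2 -> D (A1 `|` A2).
    by move=> D1 D2; rewrite -[_ `|` _]setCK setCU; apply/DC/DI; exact: DC.
  split => // [A' DA|F DF]; first by rewrite setTD; exact: DC.
  have DF' n : D (\bigcup_(i < n) F i).
    elim: n => [|n IH]; first by rewrite bigcup_mkord big_ord0.
    by rewrite bigcup_mkord big_ord_recr -bigcup_mkord; exact: DU.
  move=> f If; have [_ [C fC] _] := If.
  apply: (@phase_indistinguishable_lim
    (fun n u => f u * \1_(\bigcup_(i < n) F i) u) _ C).
  - by move=> n; exact: DF'.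
  - move=> n u; rewrite normrM -[leRHS]mulr1 ler_pM// indicE.
    by case: (_ \in _); rewrite ?normr1 ?normr0.
  move=> u; apply: cvgMr; apply: cvg_near_cst.
  have [[n _ Fnu]|nF] := pselect ((\bigcup_i F i) u).
    near=> m; rewrite !indicE !mem_set//; first by exists n.
    by exists n => //=; near: m; exact: nbhs_infty_gt.
  near=> m; rewrite !indicE !memNset// => -[k _ Fku].
  by apply: nF; exists k.
by move=> _ [i [c ->]] f; exact: phase_indistinguishable_ray.
Unshelve. all: by end_near. Qed.

End equal_laws.

(** The constant [1] is indistinguishable by assumption, hence so is the
    indicator of every set of the sigma-algebra generated by the coordinates;
    the zero phase then gives the equality of probabilities. *)
Lemma equal_characteristic_equal_law (R : realType) d (T : measurableType d)
    (P : probability T R) d' (U : measurableType d') (I : finType)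
    (pr : I -> U -> R) (X Y : T -> U) :
  (forall i, measurable_fun setT (pr i)) ->
  measurable_fun setT X -> measurable_fun setT Y ->
  (forall a b, \int[P]_w cos (\sum_i a i * pr i (X w) + b) =
               \int[P]_w cos (\sum_i a i * pr i (Y w) + b)) ->
  forall A, measurable A ->
    <<s [set A | exists i c, A = [set u | c < pr i u]] >> A ->
    P (X @^-1` A) = P (Y @^-1` A).
Proof.
move=> mpr mX mY XY A mA sA.
have I1 : phase_indistinguishable P pr X Y (cst 1).
  split=> //; first by exists 1 => u; rewrite normr1.
  by move=> a b; under eq_Rintegral do rewrite mul1r;
     under [RHS]eq_Rintegral do rewrite mul1r; exact: XY.
have [_ _ /(_ (cst 0) (0 : R))] := phase_indistinguishable_indic mpr mX mY sA I1.
have h (Z : T -> U) : measurable_fun setT Z ->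
    \int[P]_w (cst 1 (Z w) * \1_A (Z w) * phase pr (cst 0) 0 (Z w)) =
    fine (P (Z @^-1` A)).
  move=> mZ; have mZA : measurable (Z @^-1` A).
    by rewrite -[X in measurable X]setTI; exact: mZ.
  rewrite -(setIT (Z @^-1` A)) -(integral_indic _ measurableT mZA).
  congr fine; apply: eq_integral => w _; congr EFin.
  rewrite /phase big1 ?addr0 ?cos0 ?mulr1 ?mul1r//.
  by move=> i _; rewrite mul0r.
rewrite (h _ mX) (h _ mY) => e.
rewrite -[LHS]fineK ?e ?fineK// fin_num_measure// -[X in measurable X]setTI.
  exact: mY.
exact: mX.
Qed.

Section tuples_of_pairs.
Context {R : realType} (k : nat).
Let RR := (measurableTypeR R * measurableTypeR R)%type.

Definition pair_coord (i : 'I_k * bool) (u : k.-tuple RR) : R :=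
  if i.2 then (tnth u i.1).2 else (tnth u i.1).1.

Lemma measurable_pair_coord i : measurable_fun setT (pair_coord i).
Proof.
case: i => i [].
  by apply: (measurableT_comp measurable_snd); exact: measurable_tnth.
by apply: (measurableT_comp measurable_fst); exact: measurable_tnth.
Qed.

(** The product sigma-algebras on tuples and on pairs are generated by
    preimages under the projections, and the Borel sets of the line by rays. *)
Lemma measurable_tuple_rays (A : set (k.-tuple RR)) : measurable A ->
  <<s [set A | exists i c, A = [set u | c < pair_coord i u]] >> A.
Proof.
set S := <<s _ >>.
have sS : sigma_algebra setT S by exact: smallest_sigma_algebra.
have pull V (f : k.-tuple RR -> V) (G : set (set V)) :
    (forall B, G B -> S (f @^-1` B)) -> forall B, <<s G >> B -> S (f @^-1` B).
  move=> GS B sB; rewrite -[_ @^-1` _]setTI.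
  apply: (smallest_sub (X := image_set_system setT f S) _ _ sB).
    exact: sigma_algebra_image.
  by move=> C /GS; rewrite /image_set_system /= setTI.
have ray i (B : set (measurableTypeR R)) : measurable B -> S (pair_coord i @^-1` B).
  rewrite RGenOInfty.measurableE; apply: pull => _ [c ->].
  apply: sub_sigma_algebra; exists i, c.
  by apply/seteqP; split => u /=; rewrite in_itv/= andbT.
have entry (i : 'I_k) (B : set RR) : measurable B -> S ((@tnth _ RR)^~ i @^-1` B).
  apply: pull => C [] [B' mB' <-]; rewrite setTI.
    exact: (ray (i, false)).
  exact: (ray (i, true)).
rewrite -[A in S A]/(id @^-1` A); apply: pull => {A}.
elim/big_ind: _ => // [G H GS HS C [/GS|/HS]//|i _ C [B mB <-]].
by rewrite setTI; exact: entry.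
Qed.

End tuples_of_pairs.

(** * Gaussian characteristic functions: limits and second moments *)

Section trigonometric_bounds.
Context {R : realType}.
Implicit Types x y : R.

Lemma sin_mean_value y : exists2 c, `|c| <= `|y| & sin y = cos c * y.
Proof.
wlog y0 : y / 0 <= y.
  move=> H; have [/H//|/ltW y0] := leP 0 y.
  have [|c cy e] := H (- y); first by rewrite oppr_ge0.
  exists c; first by rewrite -(normrN y).
  by rewrite -[y]opprK sinN e; ring.
have [|c] := @MVT_segment R sin cos 0 y y0 (fun x _ => is_derive_sin x).
  by apply: continuous_subspaceT; exact: continuous_sin.
rewrite in_itv/= sin0 !subr0 => /andP[c0 cy] e; exists c => //.
by rewrite !ger0_norm.
Qed.

Lemma sin_norm_le y : `|sin y| <= `|y|.
Proof.
have [c _ ->] := sin_mean_value y.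
by rewrite normrM -[leRHS]mul1r ler_pM//; exact: cos_max.
Qed.

Lemma cosB_sin x y : cos x - cos y = - 2 * (sin ((x + y) / 2) * sin ((x - y) / 2)).
Proof.
rewrite [in LHS](_ : x = (x + y) / 2 + (x - y) / 2); last by field.
rewrite [in X in _ - cos X](_ : y = (x + y) / 2 - (x - y) / 2); last by field.
by rewrite (cosD ((x + y) / 2)) (cosB ((x + y) / 2)); ring.
Qed.

Lemma cos_lipschitz x y : `|cos x - cos y| <= `|x - y|.
Proof.
rewrite cosB_sin !normrM normrN normr_nat.
have h1 := sin_max ((x + y) / 2); have := sin_norm_le ((x - y) / 2).
rewrite normrM (@ger0_norm _ 2^-1)// => h2.
have := ler_pM (normr_ge0 _) (normr_ge0 _) h1 h2; lra.
Qed.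

Lemma onemcosE y : 1 - cos y = 2 * sin (y / 2) ^+ 2.
Proof. by rewrite -[X in X - _]cos0 cosB_sin add0r sub0r !mulNr sinN; ring. Qed.

Lemma onemcos_le y : 1 - cos y <= y ^+ 2 / 2.
Proof.
rewrite onemcosE -(real_normK (num_real (sin _))) -(real_normK (num_real y)).
have := sin_norm_le (y / 2); rewrite normrM (@ger0_norm _ 2^-1)// => h.
have := ler_pM (normr_ge0 _) (normr_ge0 _) h h; lra.
Qed.

(** [y - sin y = (1 - cos c) y] for some [c] between [0] and [y]. *)
Lemma sin_near_id y : `|y - sin y| <= `|y| ^+ 3.
Proof.
have [c cy ->] := sin_mean_value y.
rewrite (_ : y - cos c * y = (1 - cos c) * y); last by ring.
rewrite normrM ger0_norm ?subr_ge0 ?cos_le1// exprSr ler_wpM2r//.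
rewrite (le_trans (onemcos_le c))//.
rewrite -(real_normK (num_real c)).
have := ler_pM (normr_ge0 _) (normr_ge0 _) cy cy; have := sqr_ge0 `|c|; lra.
Qed.

Lemma cvg_harmonic_bound (u : nat -> R) (l c : R) :
  (forall n, `|u n - l| <= c * n.+1%:R^-1) -> u n @[n --> \oo] --> l.
Proof.
move=> H; apply/cvgrPdist_le => e e0.
have h : c * n.+1%:R^-1 @[n --> \oo] --> (0 : R).
  by rewrite -[X in _ --> X](mulr0 c); apply: cvgMr; exact: cvg_harmonic.
move/cvgrPdist_le : h => /(_ _ e0); apply: filterS => n.
rewrite sub0r normrN distrC => h; apply: le_trans (H n) _.
exact: le_trans (ler_norm _) h.
Qed.

Lemma cvg_scaled_sin x : n.+1%:R * sin (x / n.+1%:R) @[n --> \oo] --> x.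
Proof.
apply: (@cvg_harmonic_bound _ _ (`|x| ^+ 3)) => n.
set N : R := n.+1%:R; have N1 : 1 <= N by rewrite ler1n.
have N0 : 0 < N by rewrite (lt_le_trans ltr01).
rewrite (_ : N * _ - x = - (N * (x / N - sin (x / N)))); last first.
  by field; rewrite gt_eqF.
rewrite normrN normrM gtr0_norm//.
apply: (le_trans (ler_wpM2l (ltW N0) (sin_near_id _))).
rewrite normrM normfV (gtr0_norm N0) exprMn mulrCA ler_wpM2l ?exprn_ge0//.
rewrite exprS mulrA mulfV ?gt_eqF// mul1r expr2 -[leRHS]mul1r ler_wpM2r//.
  by rewrite invr_ge0 ltW.
by rewrite invf_le1.
Qed.

Lemma cvg_scaled_expR (v : R) : 0 <= v ->
  n.+1%:R ^+ 2 / 2 * (1 - expR (- (2 * v / n.+1%:R ^+ 2))) @[n --> \oo] --> v.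
Proof.
move=> v0; apply: (@cvg_harmonic_bound _ _ (2 * v ^+ 2)) => n.
set N : R := n.+1%:R; have N1 : 1 <= N by rewrite ler1n.
have N0 : 0 < N by rewrite (lt_le_trans ltr01).
set x := 2 * v / N ^+ 2; have x0 : 0 <= x by rewrite divr_ge0 ?mulr_ge0 ?sqr_ge0.
have vE : v = N ^+ 2 / 2 * x by rewrite /x; field; rewrite gt_eqF.
have e1 : 1 - x <= expR (- x) by exact: expR_ge1Dx.
have e2 : expR (- x) <= 1 - x + x ^+ 2.
  rewrite expRN; have h := expR_ge1Dx x.
  rewrite (@le_trans _ _ (1 + x)^-1)// ?lef_pV2 ?posrE ?expR_gt0 //; first by lra.
  by rewrite -[leLHS]mul1r ler_pdivrMr; [nra|lra].
have NN : 0 <= N ^+ 2 / 2 by rewrite divr_ge0 ?sqr_ge0.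
rewrite [X in _ - X]vE -mulrBr normrM (ger0_norm NN) ler0_norm; last by lra.
apply: (@le_trans _ _ (N ^+ 2 / 2 * x ^+ 2)); first by rewrite ler_wpM2l//; lra.
rewrite (_ : _ * _ = 2 * v ^+ 2 * (N ^+ 2)^-1); last first.
  by rewrite /x; field; rewrite gt_eqF.
rewrite ler_wpM2l ?mulr_ge0 ?sqr_ge0// lef_pV2 ?posrE ?exprn_gt0//.
by rewrite expr2 -[leLHS]mul1r ler_wpM2r// ltW.
Qed.

End trigonometric_bounds.

Section second_moment.
Context {R : realType} d (T : measurableType d) (P : probability T R).

(** With [t = 2 / N], [N^2 (1 - cos(t f)) / 2 = (N sin(f / N))^2] is dominated
    by [f^2] and converges to it, while its mean
    [N^2 (1 - exp(- 2 v / N^2)) / 2] converges to [v]. *)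
Lemma second_moment_of_characteristic (f : T -> R) (v : R) : 0 <= v ->
  measurable_fun setT f -> P.-integrable setT (fun w => (f w ^+ 2)%:E) ->
  (forall t, \int[P]_w cos (t * f w) = expR (- (t ^+ 2 * v / 2))) ->
  \int[P]_w (f w ^+ 2) = v.
Proof.
move=> v0 mf if2 H.
pose g n w : R := (n.+1%:R * sin (f w / n.+1%:R)) ^+ 2.
have mg n : measurable_fun setT (g n).
  apply: measurable_funX; apply: measurable_funM => //.
  apply: measurableT_comp; first exact: continuous_measurable_fun (@continuous_sin R).
  exact: measurable_funM.
have gf w : g n w @[n --> \oo] --> f w ^+ 2.
  rewrite expr2; apply: cvgM; exact: cvg_scaled_sin.
have gle n w : `|g n w| <= f w ^+ 2.
  rewrite /g normrX -(real_normK (num_real (f w))) lerXn2r ?nnegrE//.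
  rewrite normrM normr_nat mulrC -ler_pdivlMr ?ltr0n//.
  by rewrite (le_trans (sin_norm_le _))// normrM normfV normr_nat.
have [||||| _ _] := @dominated_convergence _ T R P setT measurableT
   (fun n => EFin \o g n) (fun w => (f w ^+ 2)%:E) (fun w => (f w ^+ 2)%:E).
- by move=> n; apply/measurable_EFinP.
- by apply/measurable_EFinP; exact: measurable_funX.
- by apply: aeW => w _; apply/fine_cvgP; split; [exact: nearW|exact: gf].
- by [].
- by apply: aeW => w n _ /=; rewrite lee_fin.
rewrite -[X in _ --> X]fineK ?integrable_fin_num// => /fine_cvg h.
apply: (cvg_unique _ h); rewrite //.
have -> : fine \o (fun n => \int[P]_w (EFin \o g n) w)%E =
   fun n => n.+1%:R ^+ 2 / 2 * (1 - expR (- (2 * v / n.+1%:R ^+ 2))).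
  apply/funext => n /=; rewrite -/(Rintegral _ _ _).
  set N : R := n.+1%:R; have N0 : N != 0 by rewrite pnatr_eq0.
  have mc : measurable_fun setT (fun w => cos (2 / N * f w)).
    apply: measurableT_comp; first exact: continuous_measurable_fun (@continuous_cos R).
    exact: measurable_funM.
  have ic : P.-integrable setT (EFin \o (fun w => cos (2 / N * f w))).
    by apply: (@bounded_integrable _ _ _ _ _ 1) => // w; exact: cos_max.
  have i1 : P.-integrable setT (EFin \o cst 1).
    by apply: (@bounded_integrable _ _ _ _ _ 1) => // w; rewrite normr1.
  have -> : 1 - expR (- (2 * v / N ^+ 2)) = \int[P]_w (1 - cos (2 / N * f w)).
    rewrite RintegralB// Rintegral_probability_cst H.
    by congr (_ - expR (- _)); field.
  rewrite -RintegralZl//; last exact: EFin_integrableB.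
  apply: eq_Rintegral => w _; rewrite /g onemcosE -/N.
  rewrite (_ : 2 / N * f w / 2 = f w / N); last by field.
  by field.
exact: cvg_scaled_expR.
Qed.

(** The cosine is 1-Lipschitz and [|x| <= e / 2 + x^2 / (e / 2)]. *)
Lemma characteristic_L2_limit (S : nat -> T -> R) (f : T -> R) (b l : R) :
  (forall n, measurable_fun setT (S n)) -> measurable_fun setT f ->
  (\int[P]_w ((S n w - f w) ^+ 2)%:E)%E @[n --> \oo] --> 0%E ->
  \int[P]_w cos (S n w + b) @[n --> \oo] --> l ->
  \int[P]_w cos (f w + b) = l.
Proof.
move=> mS mf cS; apply: cvg_unique => //.
have mcos (g : T -> R) : measurable_fun setT g ->
    measurable_fun setT (fun w => cos (g w + b)).
  move=> mg; apply: measurableT_comp.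
    exact: continuous_measurable_fun (@continuous_cos R).
  exact: measurable_funD.
have icos (g : T -> R) : measurable_fun setT g ->
    P.-integrable setT (EFin \o fun w => cos (g w + b)).
  move=> /mcos mg.
  by apply: (@bounded_integrable _ _ _ _ _ 1) => // w; exact: cos_max.
apply/cvgrPdist_le => e e0; have e20 : 0 < e / 2 by rewrite divr_gt0.
have : \forall n \near \oo, (\int[P]_w ((S n w - f w) ^+ 2)%:E <= ((e / 2) ^+ 2)%:E)%E.
  have /fine_cvgP[fS /cvgr_le h] := cS.
  have := h ((e / 2) ^+ 2) _; rewrite exprn_gt0// => /(_ isT) h'.
  by apply: filterS2 fS h' => n fn hn; rewrite -[leLHS]fineK// lee_fin.
apply: filterS => n hn.
rewrite -RintegralB//; [|exact: icos..].
rewrite -lee_fin; apply: (@le_trans _ _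
  (\int[P]_w `|cos (f w + b) - cos (S n w + b)|%:E)%E).
  rewrite EFin_normr_Rintegral//; last by apply: EFin_integrableB; exact: icos.
  apply: le_abse_integral => //; apply/measurable_EFinP.
  by apply: measurable_funB; exact: mcos.
apply: (@le_trans _ _
  (\int[P]_w ((e / 2)%:E + ((e / 2)^-1)%:E * ((S n w - f w) ^+ 2)%:E))%E).
  apply: ge0_le_integral => //.
  - apply/measurable_EFinP; apply: measurableT_comp => //.
    by apply: measurable_funB; exact: mcos.
  - apply/measurable_EFinP; apply: measurable_funD => //.
    by apply: measurable_funM => //; apply: measurable_funX; exact: measurable_funB.
  - move=> w _; rewrite -EFinM -EFinD lee_fin.
    apply: le_trans (cos_lipschitz _ _) _.
    rewrite opprD addrACA subrr addr0 distrC -(real_normK (num_real (S n w - f w))).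
    set x := `|_|; have x0 : 0 <= x by exact: normr_ge0.
    rewrite -(ler_pM2l e20) mulrDr mulrA divff ?gt_eqF// mul1r; nra.
rewrite ge0_integralD//; first last.
- apply/measurable_EFinP; apply: measurable_funM => //.
  by apply: measurable_funX; exact: measurable_funB.
- by move=> w _; rewrite mule_ge0// lee_fin ?sqr_ge0// invr_ge0 ltW.
- by move=> w _; rewrite lee_fin ltW.
rewrite ge0_integralZl//; first last.
- by rewrite lee_fin invr_ge0 ltW.
- by move=> w _; rewrite lee_fin sqr_ge0.
- apply/measurable_EFinP.
  by apply: measurable_funX; exact: measurable_funB.
rewrite integral_cst// (_ : (_ * P setT)%E = (e / 2)%:E); last first.
  by rewrite -[RHS]mule1; congr (_ * _)%E; exact: (probability_setT P).
apply: (@le_trans _ _ ((e / 2)%:E + ((e / 2)^-1)%:E * ((e / 2) ^+ 2)%:E)%E).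
  by rewrite leeD2l// lee_pmul2l// lte_fin invr_gt0.
by rewrite -EFinM -EFinD lee_fin expr2 mulKf ?gt_eqF// -splitr.
Qed.

End second_moment.

(** * Orthonormality of the Hermite functions *)

Section hermite_orthonormality.
Context {R : realType}.
Local Notation mu := (@lebesgue_measure R).
Implicit Types p q : {poly R}.

Lemma continuous_gaussM (c : R) p : continuous (gaussM c p).
Proof.
move=> x; have [dg _] := is_derive_gaussM c p x.
exact/differentiable_continuous/derivable1_diffP.
Qed.

Lemma measurable_gaussM (c : R) p : measurable_fun setT (gaussM c p).
Proof. by apply: continuous_measurable_fun; exact: continuous_gaussM. Qed.

(** Half of the Gaussian decay absorbs the polynomial, the other half is
    integrable. *)
Lemma integrable_gaussM1 p : mu.-integrable setT (EFin \o gaussM 1 p).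
Proof.
have h2 : 0 < 2^-1 :> R by rewrite invr_gt0.
have [C HC] := gaussM_bounded p h2.
have := EFin_integrableZ (C * (normal_peak 1)^-1) (integrable_normal_pdf (0 : R) 1).
apply: le_integrable => //.
  by apply/measurable_EFinP; exact: measurable_gaussM.
move=> x _ /=; rewrite lee_fin normal_pdfE ?oner_neq0//=.
have pk0 := @normal_peak_gt0 R 1 (oner_neq0 _).
rewrite mulrA mulfVK ?gt_eqF// /normal_fun subr0 expr1n.
have -> : gaussM 1 p x = gaussM 2^-1 p x * expR (- x ^+ 2 / 2).
  rewrite /gaussM -mulrA -expRD; by congr (_ * expR _); field.
rewrite normrM [leRHS]normrM !(ger0_norm (expR_ge0 _)).
rewrite ler_wpM2r ?expR_ge0//.
exact: le_trans (HC x) (ler_norm _).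
Qed.

Definition gauss_mean p : R := \int[mu]_x gaussM 1 p x.

Lemma gauss_meanD p q : gauss_mean (p + q) = gauss_mean p + gauss_mean q.
Proof.
rewrite /gauss_mean -RintegralD//; [|exact: integrable_gaussM1..].
by apply: eq_Rintegral => x _; rewrite /gaussM hornerD mulrDl.
Qed.

Lemma gauss_meanZ (a : R) p : gauss_mean (a *: p) = a * gauss_mean p.
Proof.
rewrite /gauss_mean -RintegralZl//; [|exact: integrable_gaussM1..].
by apply: eq_Rintegral => x _; rewrite /gaussM hornerZ -mulrA.
Qed.

Lemma gauss_mean1 : gauss_mean 1 = Num.sqrt pi.
Proof.
rewrite /gauss_mean /Rintegral.
have := @integralT_gauss R => /(congr1 fine) /= <-; congr fine.
apply: eq_integral => x _; congr EFin; rewrite /gaussM /gauss_fun hornerE !mul1r.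
by [].
Qed.

(** The integrand is the derivative of [p(x) exp(-x^2)], which vanishes at
    infinity. *)
Lemma gauss_mean_parts p : gauss_mean (p^`() - (1 *+ 2) *: 'X * p) = 0.
Proof.
set q := _ - _; pose F := gaussM 1 p; pose f := gaussM 1 q.
have [C HC] := @gaussM_bounded R 1 ('X * p) ltr01.
have XF x : gaussM 1 ('X * p) x = F x * x.
  by rewrite /F /gaussM hornerM hornerX; ring.
have Fle x : 0 < x -> `|F x| <= C / x.
  by move=> x0; rewrite ler_pdivlMr// -[X in _ * X]gtr0_norm// -normrM -XF.
have FNle x : 0 < x -> `|F (- x)| <= C / x.
  move=> x0; rewrite ler_pdivlMr// -[X in _ * X]gtr0_norm// -normrM.
  by rewrite -normrN -mulrN -XF.
pose D (n : nat) : set R := `[- n.+1%:R, n.+1%:R]%classic.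
have iD n : \int[mu]_x (f \_ (D n)) x = F n.+1%:R - F (- n.+1%:R).
  rewrite -Rintegral_mkcond /Rintegral (@continuous_FTC2 _ f F)//.
  - by rewrite gtrN// ltr0n.
  - by apply: continuous_subspaceT; exact: continuous_gaussM.
  - split.
    + by move=> x _; have [] := is_derive_gaussM 1 p x.
    + exact/cvg_at_right_filter/continuous_gaussM.
    + exact/cvg_at_left_filter/continuous_gaussM.
  - by move=> x _; rewrite derive1E; have [_ ->] := is_derive_gaussM 1 p x.
have [||||| _ _] := @dominated_convergence _ _ R mu setT measurableT
   (fun n => EFin \o (f \_ (D n))) (EFin \o f) (EFin \o (fun x => `|f x|)).
- move=> n; apply/measurable_EFinP/(measurable_restrictT _ _).1 => //.
    exact: measurable_itv.
  by apply: measurable_funTS; exact: measurable_gaussM.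
- by apply/measurable_EFinP; exact: measurable_gaussM.
- apply: aeW => x _; apply/fine_cvgP; split; first exact: nearW.
  apply: cvg_near_cst; near=> n; rewrite /= patchE mem_set//=.
  rewrite /D /= in_itv/= -ler_norml (@le_trans _ _ n%:R)// ?ler_nat//.
  near: n; exact: nbhs_infty_ger.
- exact: integrable_abse (integrable_gaussM1 q).
- apply: aeW => x n _ /=; rewrite lee_fin patchE.
  by case: ifP => // _; rewrite normr0.
rewrite -[X in _ --> X]fineK ?integrable_fin_num//; last exact: integrable_gaussM1.
move=> /fine_cvg h; apply: (cvg_unique _ h); rewrite //.
apply: (@cvg_harmonic_bound _ _ _ (C + C)) => n.
rewrite [X in X - _]/= -[X in X - _]/(Rintegral mu setT _) iD subr0.
rewrite (le_trans (ler_normB _ _))// mulrDl.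
by rewrite lerD// ?Fle ?FNle// ltr0n.
Unshelve. all: by end_near. Qed.

(** [(-1)^n] times the physicists' Hermite polynomial of index [n]. *)
Fixpoint rodrigues (n : nat) : {poly R} :=
  if n is n'.+1 then (rodrigues n')^`() - (1 *+ 2) *: 'X * rodrigues n' else 1.

Lemma derive1n_gauss_fun n : derive1n n gauss_fun = gaussM 1 (rodrigues n).
Proof.
elim: n => [|n IH].
  by apply/funext => x; rewrite /gaussM hornerE !mul1r.
rewrite derive1nS IH; apply/funext => x.
by rewrite derive1E; have [_ ->] := is_derive_gaussM 1 (rodrigues n) x.
Qed.

(** Moving one factor of the Rodrigues operator [q |-> q' - 2 X q] across the
    Gaussian mean turns it into [- d/dx]; iterating, orthogonality and the norms
    follow from the degree and the leading coefficient alone. *)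
Lemma gauss_mean_rodrigues n p :
  gauss_mean (p * rodrigues n) = (-1) ^+ n * gauss_mean p^`(n).
Proof.
elim: n p => [|n IH] p; first by rewrite /= mulr1 expr0 mul1r.
have := gauss_mean_parts (p * rodrigues n).
rewrite derivM -addrA [X in p^`() * _ + X](_ : _ = p * rodrigues n.+1); last first.
  by rewrite /=; ring.
rewrite gauss_meanD IH -derivSn => /eqP; rewrite addrC addr_eq0 => /eqP ->.
by rewrite exprS; ring.
Qed.

Lemma coef_rodrigues n k : (n <= k)%N ->
  (rodrigues n)`_k = (if k == n then (-2) ^+ n else 0) :> R.
Proof.
elim: n k => [|n IH] [|k] //=; rewrite ?coef1// => nk.
rewrite coefB coef_deriv -scalerAl coefZ coefXM /= !IH//; last first.
  exact: leqW (ltnW nk).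
rewrite [k.+2 == n]gtn_eqF ?ltnS ?(ltnW nk)// mul0rn sub0r eqSS.
by case: ifP => _; rewrite ?mulr0 ?oppr0// exprS; ring.
Qed.

Lemma derivn_rodrigues m n : (m <= n)%N ->
  (rodrigues m)^`(n) = (if n == m then (-2) ^+ n * n`!%:R else 0 : R)%:P.
Proof.
move=> mn; apply/polyP => i; rewrite coef_derivn coefC.
rewrite coef_rodrigues; last exact: leq_trans mn (leq_addr _ _).
case: i => [|i]; rewrite ?addn0 ?eqxx.
  by case: eqP => [->|_]; rewrite ?mul0rn// ffactnn mulr_natr.
by rewrite gtn_eqF ?mul0rn// addnS ltnS (leq_trans mn)// leq_addr.
Qed.

Lemma hermite_funE n (x : R) : hermite_fun n x =
  (-1) ^+ n / Num.sqrt (2 ^+ n * n`!%:R * Num.sqrt pi) *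
  expR (x ^+ 2 / 2) * gaussM 1 (rodrigues n) x.
Proof. by rewrite /hermite_fun derive1n_gauss_fun. Qed.

Lemma hermite_funM m n (x : R) : hermite_fun m x * hermite_fun n x =
  ((-1) ^+ m / Num.sqrt (2 ^+ m * m`!%:R * Num.sqrt pi)) *
  ((-1) ^+ n / Num.sqrt (2 ^+ n * n`!%:R * Num.sqrt pi)) *
  gaussM 1 (rodrigues m * rodrigues n) x.
Proof.
have e1 : expR (x ^+ 2 / 2) * expR (x ^+ 2 / 2) * expR (- (1 * x ^+ 2)) = 1 :> R.
  by rewrite -!expRD -splitr mul1r subrr expR0.
rewrite !hermite_funE /gaussM hornerM; set E := expR (x ^+ 2 / 2).
set G := expR (- (1 * x ^+ 2)) in e1 *; set a := _ / _; set b := _ / _.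
transitivity (a * b * (rodrigues m).[x] * (rodrigues n).[x] * G * (E * E * G)).
  by ring.
by rewrite e1; ring.
Qed.

Lemma integrable_hermite_funM m n :
  mu.-integrable setT (EFin \o fun x => hermite_fun m x * hermite_fun n x).
Proof.
have := EFin_integrableZ
  (((-1) ^+ m / Num.sqrt (2 ^+ m * m`!%:R * Num.sqrt pi)) *
   ((-1) ^+ n / Num.sqrt (2 ^+ n * n`!%:R * Num.sqrt pi)))
  (integrable_gaussM1 (rodrigues m * rodrigues n)).
by apply: eq_integrable => // x _ /=; rewrite hermite_funM.
Qed.

Lemma hermite_fun_orthonormal m n :
  \int[mu]_x (hermite_fun m x * hermite_fun n x) = (m == n)%:R.
Proof.
wlog mn : m n / (m <= n)%N.
  move=> H; have [/H//|/ltnW/H] := leqP m n.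
  by rewrite eq_sym => <-; apply: eq_Rintegral => x _; rewrite mulrC.
under eq_Rintegral do rewrite hermite_funM.
rewrite RintegralZl//; last exact: integrable_gaussM1.
rewrite -/(gauss_mean _) gauss_mean_rodrigues derivn_rodrigues// (eq_sym n).
case: eqP => [->|_]; last first.
  by rewrite -[0%:P]mulr1 mul_polyC gauss_meanZ mul0r !mulr0.
rewrite -[_%:P]mulr1 mul_polyC gauss_meanZ gauss_mean1.
set s := Num.sqrt (_ * _ * _).
have s0 : 0 < 2 ^+ n * n`!%:R * Num.sqrt pi :> R.
  by rewrite !mulr_gt0 ?exprn_gt0 ?ltr0n ?fact_gt0// sqrtr_gt0 pi_gt0.
have ss : s * s = 2 ^+ n * n`!%:R * Num.sqrt pi by rewrite -expr2 sqr_sqrtr// ltW.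
have sn0 : s != 0 by rewrite sqrtr_eq0 -ltNge.
have e1 : (-1) ^+ n * (-1) ^+ n = 1 :> R by rewrite -exprMn mulrNN mulr1 expr1n.
have e2 : (-1) ^+ n * (-2) ^+ n = 2 ^+ n :> R by rewrite -exprMn mulrNN mul1r.
transitivity ((-1) ^+ n * (-1) ^+ n *
  ((-1) ^+ n * (-2) ^+ n * n`!%:R * Num.sqrt pi) / (s * s)); first by field.
by rewrite e1 e2 mul1r ss divff// gt_eqF.
Qed.

Lemma hermite_sum_norm N (c : 'I_N -> R) :
  \int[mu]_x ((\sum_(n < N) c n * hermite_fun n x) ^+ 2) = \sum_(n < N) c n ^+ 2.
Proof.
under eq_Rintegral do rewrite expr2 big_distrlr /=.
rewrite Rintegral_sum; last first.
  move=> i; apply: EFin_integrable_sum => j.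
  have := EFin_integrableZ (c i * c j) (integrable_hermite_funM i j).
  by apply: eq_integrable => // x _ /=; congr EFin; ring.
apply: eq_bigr => i _; rewrite Rintegral_sum; last first.
  move=> j; have := EFin_integrableZ (c i * c j) (integrable_hermite_funM i j).
  by apply: eq_integrable => // x _ /=; congr EFin; ring.
have e (j : 'I_N) : \int[mu]_x (c i * hermite_fun i x * (c j * hermite_fun j x)) =
    c i * c j * (i == j)%:R.
  rewrite -(hermite_fun_orthonormal i j) -RintegralZl//.
    by apply: eq_Rintegral => x _; ring.
  exact: integrable_hermite_funM.
rewrite (eq_bigr _ (fun j _ => e j)) (bigD1 i)//= eqxx mulr1 big1 ?addr0//.
by move=> j ji; rewrite -val_eqE eq_sym val_eqE (negPf ji) mulr0.
Qed.

End hermite_orthonormality.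

(** * The norm of complex-valued square-integrable functions *)

Section complex_L2_norm.
Context {R : realType} d (T : measurableType d) (mu : {measure set T -> \bar R}).
Implicit Types f : T -> R[i].

Lemma normc_sqr (z : R[i]) :
  Normc.normc z ^+ 2 = complex.Re z ^+ 2 + complex.Im z ^+ 2.
Proof. by case: z => a b /=; rewrite sqr_sqrtr// addr_ge0 ?sqr_ge0. Qed.

Lemma L2normE f : L2norm mu f =
  ((\int[mu]_x (complex.Re (f x) ^+ 2 + complex.Im (f x) ^+ 2)%:E) `^ 2^-1)%E.
Proof.
rewrite /L2norm unlock /=; congr (_ `^ _)%E; apply: eq_integral => x _.
congr EFin.
by rewrite (@powR_mulrn _ _ 2)// real_normK ?num_real// normc_sqr.
Qed.

Lemma L2norm_le_integral f (e : R) : (L2norm mu f <= e%:E)%E ->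
  (\int[mu]_x (complex.Re (f x) ^+ 2 + complex.Im (f x) ^+ 2)%:E <= (e ^+ 2)%:E)%E.
Proof.
rewrite L2normE; set I := integral _ _ _ => Ie.
have I0 : (0 <= I)%E.
  by apply: integral_ge0 => x _; rewrite lee_fin addr_ge0 ?sqr_ge0.
have -> : I = ((I `^ 2^-1) `^ 2)%E by rewrite -poweRrM mulVf// poweRe1.
have e0 : 0 <= e by rewrite -lee_fin (le_trans _ Ie)// poweR_ge0.
rewrite -(@powR_mulrn _ e 2)// -poweR_EFin gt0_ler_poweR// in_itv/= ?leey ?andbT//.
by rewrite poweR_ge0.
Qed.

Lemma cvg_L2norm_integral (f_ : nat -> T -> R[i]) :
  L2norm mu (f_ n) @[n --> \oo] --> 0%E ->
  (\int[mu]_x (complex.Re (f_ n x) ^+ 2 + complex.Im (f_ n x) ^+ 2)%:E)%E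
    @[n --> \oo] --> 0%E.
Proof.
move=> /fine_cvgP[ff h].
have H e : 0 < e -> \forall n \near \oo,
    (\int[mu]_x (complex.Re (f_ n x) ^+ 2 + complex.Im (f_ n x) ^+ 2)%:E
       <= (e ^+ 2)%:E)%E.
  move=> e0; move/cvgrPdist_le : h => /(_ _ e0).
  apply: filterS2 ff => n ff; rewrite sub0r normrN /= => he.
  apply: L2norm_le_integral; rewrite -[leLHS]fineK// lee_fin.
  exact: le_trans (ler_norm _) he.
have I0 n : (0 <= \int[mu]_x (complex.Re (f_ n x) ^+ 2 + complex.Im (f_ n x) ^+ 2)%:E)%E.
  by apply: integral_ge0 => x _; rewrite lee_fin addr_ge0 ?sqr_ge0.
apply/fine_cvgP; split.
  apply: filterS (H 1 ltr01) => n hn.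
  by rewrite ge0_fin_numE// (le_lt_trans hn)// ltry.
apply/cvgrPdist_le => e e0.
have se0 : 0 < Num.sqrt e by rewrite sqrtr_gt0.
apply: filterS (H _ se0) => n; rewrite (sqr_sqrtr (ltW e0)) => hn.
rewrite sub0r normrN /= ger0_norm ?fine_ge0// -lee_fin fineK//.
by rewrite ge0_fin_numE// (le_lt_trans hn)// ltry.
Qed.

End complex_L2_norm.

(** * Parseval identity for a symmetric measure with an exponential basis *)

Section symmetric_spectral_measure.
Context {R : realType} (sigma : probability (measurableTypeR R) R).
Hypothesis sigma_sym : forall A : set (measurableTypeR R),
  measurable A -> sigma [set u | A (- u)] = sigma A.

Lemma symmetric_integral (f : measurableTypeR R -> R) :
  measurable_fun setT f -> (forall u, 0 <= f u) ->
  (\int[sigma]_u (f (- u))%:E = \int[sigma]_u (f u)%:E)%E.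
Proof.
move=> mf f0; pose opp (u : measurableTypeR R) : measurableTypeR R := - u.
have mopp : measurable_fun setT opp by exact: oppr_measurable.
rewrite -(@ge0_integral_pushforward _ _ _ _ R opp mopp sigma setT
  (EFin \o f))//; last 2 first.
- exact/measurable_EFinP.
- by move=> u _; rewrite lee_fin.
by apply: eq_measure_integral => A mA _; exact: sigma_sym.
Qed.

Definition spectral_cov (s : R) : R := \int[sigma]_u cos (s * u).
Local Notation K := spectral_cov.

Lemma measurable_cosM (s : R) :
  measurable_fun setT (fun u : measurableTypeR R => cos (s * u)).
Proof.
apply: measurableT_comp; first exact: continuous_measurable_fun (@continuous_cos R).
exact: measurable_funM.
Qed.

Lemma measurable_sinM (s : R) :
  measurable_fun setT (fun u : measurableTypeR R => sin (s * u)).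
Proof.
apply: measurableT_comp; first exact: continuous_measurable_fun (@continuous_sin R).
exact: measurable_funM.
Qed.

Lemma integrable_cosM (s : R) :
  sigma.-integrable setT (EFin \o fun u : measurableTypeR R => cos (s * u)).
Proof.
apply: (@bounded_integrable _ _ _ _ _ 1); first exact: measurable_cosM.
by move=> u; exact: cos_max.
Qed.

(** The imaginary part is the integral of an odd function; symmetry is applied
    to the nonnegative function [1 - sin]. *)
Lemma fourier_real t : fourier sigma t = Complex (K t) 0.
Proof.
rewrite /fourier /Cintegral /=; congr Complex.
have msin := measurable_sinM t.
have isin : sigma.-integrable setT (EFin \o fun u : measurableTypeR R => sin (t * u)).
  by apply: (@bounded_integrable _ _ _ _ _ 1) => // u; exact: sin_max.
have i1 : sigma.-integrable setT (EFin \o cst 1).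
  by apply: (@bounded_integrable _ _ _ _ _ 1) => // u; rewrite normr1.
have m1 : measurable_fun setT (fun u : measurableTypeR R => 1 - sin (t * u)).
  exact: measurable_funB.
have p1 u : 0 <= 1 - sin (t * u) by rewrite subr_ge0 sin_le1.
have := symmetric_integral m1 p1 => /(congr1 fine).
have -> : fine (\int[sigma]_u (1 - sin (t * - u))%:E)%E =
    \int[sigma]_u (1 + sin (t * u)).
  by apply: eq_Rintegral => u _; rewrite mulrN sinN opprK.
rewrite -/(Rintegral _ _ _) RintegralD// RintegralB// => e; lra.
Qed.

Lemma spectral_cov0 : K 0 = 1.
Proof.
rewrite -[RHS](Rintegral_probability_cst sigma).
by apply: eq_Rintegral => u _; rewrite mul0r cos0.
Qed.

Lemma spectral_covN s : K (- s) = K s.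
Proof. by apply: eq_Rintegral => u _; rewrite mulNr cosN. Qed.

Implicit Types l m : seq (R * R).

(** The inner product in [L2(sigma)] of two trigonometric sums
    [\sum a e^{i t u}] with real coefficients, each given by the list of its
    pairs [(a, t)].  Lists make concatenation the sum of such functions. *)
Definition gram l m : R :=
  \sum_(x <- l) \sum_(y <- m) x.1 * y.1 * K (x.2 - y.2).

Lemma gramC l m : gram l m = gram m l.
Proof.
rewrite /gram exchange_big; apply: eq_bigr => x _; apply: eq_bigr => y _.
by rewrite -spectral_covN opprB (mulrC y.1).
Qed.

Lemma gram_catl l1 l2 m : gram (l1 ++ l2) m = gram l1 m + gram l2 m.
Proof. exact: big_cat. Qed.

Lemma gram_cat l m : gram (l ++ m) (l ++ m) = gram l l + 2 * gram l m + gram m m.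
Proof.
rewrite gram_catl (gramC l) (gramC m (_ ++ _)) !gram_catl (gramC m l); ring.
Qed.

Lemma gramE l : gram l l = \int[sigma]_u
  ((\sum_(x <- l) x.1 * cos (x.2 * u)) ^+ 2 +
   (\sum_(x <- l) x.1 * sin (x.2 * u)) ^+ 2).
Proof.
have e (u : R) : (\sum_(x <- l) x.1 * cos (x.2 * u)) ^+ 2 +
   (\sum_(x <- l) x.1 * sin (x.2 * u)) ^+ 2 =
   \sum_(x <- l) \sum_(y <- l) x.1 * y.1 * cos ((x.2 - y.2) * u).
  rewrite !expr2 !big_distrlr -big_split /=; apply: eq_bigr => x _.
  rewrite -big_split /=; apply: eq_bigr => y _.
  by rewrite mulrBl cosB; ring.
under eq_Rintegral do rewrite e.
rewrite Rintegral_sum; last first.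
  move=> x; apply: EFin_integrable_sum => y.
  exact: EFin_integrableZ (integrable_cosM _).
apply: eq_bigr => x _; rewrite Rintegral_sum; last first.
  by move=> y; exact: EFin_integrableZ (integrable_cosM _).
apply: eq_bigr => y _; rewrite RintegralZl//; exact: integrable_cosM.
Qed.

Lemma gram_ge0 l : 0 <= gram l l.
Proof. by rewrite gramE Rintegral_ge0// => u _; rewrite addr_ge0 ?sqr_ge0. Qed.

Variable lambda : nat -> R.
Hypothesis lambda_orth : forall i j : nat, K (lambda i - lambda j) = (i == j)%:R.

(** The inner product of a trigonometric sum with [e_{lambda n}]. *)
Definition spectral_coef l n : R := \sum_(x <- l) x.1 * K (x.2 - lambda n).

(** The squared distance from a trigonometric sum to the span of the first [N]
    exponentials [e_{lambda n}]. *)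
Definition bessel_defect l N : R :=
  gram l l - \sum_(n < N) spectral_coef l n ^+ 2.

(** Pythagoras: subtracting a combination with coefficients [c] leaves the
    distance to the span plus the error on the coefficients. *)
Lemma gram_basis l N (c : 'I_N -> R) :
  let m := [seq (- c n, lambda n) | n <- enum 'I_N] in
  gram (l ++ m) (l ++ m) =
  bessel_defect l N + \sum_(n < N) (spectral_coef l n - c n) ^+ 2.
Proof.
move=> m; rewrite gram_cat.
have -> : gram l m = - \sum_(n < N) c n * spectral_coef l n.
  rewrite gramC /gram /m big_map big_enum /= -sumrN; apply: eq_bigr => n _.
  rewrite -mulNr mulr_sumr; apply: eq_bigr => x _ /=.
  by rewrite -spectral_covN opprB mulrA.
have -> : gram m m = \sum_(n < N) c n ^+ 2.
  rewrite /gram /m big_map big_enum /=; apply: eq_bigr => n _.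
  rewrite big_map big_enum /= (bigD1 n)//= lambda_orth eqxx mulr1 big1 ?addr0.
    by rewrite mulrNN expr2.
  by move=> k kn; rewrite lambda_orth val_eqE eq_sym (negPf kn) mulr0.
rewrite /bessel_defect -addrA -addrA; congr (_ + _).
rewrite mulrN mulr_sumr -!sumrN -!big_split /=; apply: eq_bigr => n _; ring.
Qed.

Lemma bessel_defect_ge0 l N : 0 <= bessel_defect l N.
Proof.
have := gram_ge0 (l ++ [seq (- spectral_coef l n, lambda n) | n : 'I_N]).
rewrite gram_basis big1 ?addr0// => n _; by rewrite subrr expr0n.
Qed.

Lemma bessel_defect_nonincreasing l (m n : nat) :
  (m <= n)%N -> bessel_defect l n <= bessel_defect l m.
Proof.
move=> mn; rewrite lerD2l lerN2 -!(big_mkord xpredT (fun k => spectral_coef l k ^+ 2)).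
rewrite [leRHS](@big_cat_nat _ _ _ m)//= lerDl sumr_ge0// => k _; exact: sqr_ge0.
Qed.

(** The defect is a nonnegative quadratic form, so the parallelogram identity
    bounds it on a sum by its values on the summands. *)
Lemma bessel_defect_cons x l N : bessel_defect (x :: l) N <=
  2 * (x.1 ^+ 2 * bessel_defect [:: (1, x.2)] N + bessel_defect l N).
Proof.
pose x' := (- x.1, x.2).
suff e : bessel_defect (x :: l) N + bessel_defect (x' :: l) N =
    2 * (x.1 ^+ 2 * bessel_defect [:: (1, x.2)] N + bessel_defect l N).
  by rewrite -e lerDl bessel_defect_ge0.
rewrite /bessel_defect -![_ :: l]cat1s !gram_cat.
have -> : gram [:: x'] l = - gram [:: x] l.
  rewrite /gram !big_seq1 -sumrN; apply: eq_bigr => y _ /=; ring.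
rewrite /gram !big_seq1 /= !subrr spectral_cov0 -/(gram l l).
rewrite (eq_bigr (fun n : 'I_N => (x.1 * K (x.2 - lambda n) + spectral_coef l n) ^+ 2));
  last by move=> n _; rewrite /spectral_coef big_cons.
rewrite [\sum_(n < N) spectral_coef (x' :: l) n ^+ 2](eq_bigr
  (fun n : 'I_N => (- x.1 * K (x.2 - lambda n) + spectral_coef l n) ^+ 2));
  last by move=> n _; rewrite /spectral_coef big_cons.
rewrite [\sum_(n < N) spectral_coef [:: _] n ^+ 2](eq_bigr
  (fun n : 'I_N => K (x.2 - lambda n) ^+ 2));
  last by move=> n _; rewrite /spectral_coef big_seq1 /= mul1r.
set s1 := \sum_(i < N) (x.1 * _ + _) ^+ 2; set s2 := \sum_(i < N) (- x.1 * _ + _) ^+ 2.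
set s3 := \sum_(i < N) K _ ^+ 2; set s4 := \sum_(i < N) spectral_coef l i ^+ 2.
have key : s1 + s2 = 2 * (x.1 ^+ 2 * s3 + s4).
  rewrite -big_split /= mulr_sumr -big_split /= mulr_sumr.
  by apply: eq_bigr => n _; ring.
rewrite [LHS](_ : _ = 2 * (x.1 ^+ 2 + gram l l) - (s1 + s2)); last by ring.
by rewrite key; ring.
Qed.

Hypothesis lambda_dense : forall (t e : R), 0 < e ->
  exists N (c : 'I_N -> R[i]), (L2norm sigma (fun u =>
    (expi (t * u) - \sum_(n < N) c n * expi (lambda n * u))%R) < e%:E)%E.

(** Averaging [|g(u)|^2] and [|g(-u)|^2] removes the cross terms, so the
    imaginary parts of the coefficients can only increase the norm. *)
Lemma gram_le_L2norm t N (c : 'I_N -> R[i]) (e : R) l :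
  l = (1, t) :: [seq (- complex.Re (c n), lambda n) | n : 'I_N] ->
  (L2norm sigma (fun u =>
    (expi (t * u) - \sum_(n < N) c n * expi (lambda n * u))%R) < e%:E)%E ->
  gram l l <= e ^+ 2.
Proof.
move=> lE ce0; have ce := L2norm_le_integral (ltW ce0).
pose A (u : R) := cos (t * u) - \sum_(n < N) complex.Re (c n) * cos (lambda n * u).
pose S (u : R) := sin (t * u) - \sum_(n < N) complex.Re (c n) * sin (lambda n * u).
pose B (u : R) := \sum_(n < N) complex.Im (c n) * sin (lambda n * u).
pose D (u : R) := \sum_(n < N) complex.Im (c n) * cos (lambda n * u).
have mA : measurable_fun setT (A : measurableTypeR R -> R).
  apply: measurable_funB; first exact: measurable_cosM.
  by apply: measurable_sum => n; apply: measurable_funM => //; exact: measurable_cosM.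
have mS : measurable_fun setT (S : measurableTypeR R -> R).
  apply: measurable_funB; first exact: measurable_sinM.
  by apply: measurable_sum => n; apply: measurable_funM => //; exact: measurable_sinM.
have mB : measurable_fun setT (B : measurableTypeR R -> R).
  by apply: measurable_sum => n; apply: measurable_funM => //; exact: measurable_sinM.
have mD : measurable_fun setT (D : measurableTypeR R -> R).
  by apply: measurable_sum => n; apply: measurable_funM => //; exact: measurable_cosM.
pose G (u : R) := (A u + B u) ^+ 2 + (S u - D u) ^+ 2.
have mG : measurable_fun setT (G : measurableTypeR R -> R).
  by apply: measurable_funD; apply: measurable_funX;
     [exact: measurable_funD|exact: measurable_funB].
have G0 u : 0 <= G u by rewrite addr_ge0 ?sqr_ge0.
have GN u : G (- u) = (A u - B u) ^+ 2 + (- S u - D u) ^+ 2.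
  rewrite /G /A /S /B /D !mulrN cosN sinN.
  have e1 (a : 'I_N -> R) :
      \sum_(n < N) a n * cos (lambda n * - u) = \sum_(n < N) a n * cos (lambda n * u).
    by apply: eq_bigr => n _; rewrite mulrN cosN.
  have e2 (a : 'I_N -> R) :
      \sum_(n < N) a n * sin (lambda n * - u) = - \sum_(n < N) a n * sin (lambda n * u).
    by rewrite -sumrN; apply: eq_bigr => n _; rewrite mulrN sinN mulrN.
  by rewrite !e1 !e2; ring.
have IG : (\int[sigma]_u (G u)%:E <= (e ^+ 2)%:E)%E.
  apply: le_trans ce; rewrite le_eqVlt; apply/orP; left; apply/eqP.
  apply: eq_integral => u _; congr EFin; congr (_ ^+ 2 + _ ^+ 2).
    rewrite raddfB raddf_sum /A /B -addrA; congr (_ + _).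
    rewrite addrC -opprB; congr (- _); rewrite -sumrB; apply: eq_bigr => n _.
    by case: (c n).
  rewrite raddfB /S /D -addrA; congr (_ + _).
  rewrite [in RHS]raddf_sum -opprD; congr (- _); rewrite -big_split; apply: eq_bigr => n _.
  by case: (c n) => a b /=; ring.
have Ih : (\int[sigma]_u (A u ^+ 2 + S u ^+ 2)%:E <= (e ^+ 2)%:E)%E.
  apply: (@le_trans _ _ (\int[sigma]_u (2^-1%:E * ((G u)%:E + (G (- u))%:E)))%E).
    apply: ge0_le_integral => //.
    - by move=> u _; rewrite lee_fin addr_ge0 ?sqr_ge0.
    - by apply/measurable_EFinP; apply: measurable_funD; exact: measurable_funX.
    - apply/measurable_EFinP; apply: measurable_funM => //.
      apply: measurable_funD => //; apply: (measurableT_comp mG).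
      exact: oppr_measurable.
    - move=> u _; rewrite -EFinD -EFinM lee_fin GN /G.
      have := sqr_ge0 (B u); have := sqr_ge0 (D u); lra.
  rewrite ge0_integralZl//; first last.
  - by move=> u _; rewrite adde_ge0// lee_fin.
  - apply/measurable_EFinP.
    apply: measurable_funD => //; apply: (measurableT_comp mG).
    exact: oppr_measurable.
  rewrite ge0_integralD//; first last.
  - apply/measurable_EFinP; apply: (measurableT_comp mG); exact: oppr_measurable.
  - by move=> u _; rewrite lee_fin.
  - exact/measurable_EFinP.
  - by move=> u _; rewrite lee_fin.
  rewrite symmetric_integral//.
  apply: (@le_trans _ _ (2^-1%:E * ((e ^+ 2)%:E + (e ^+ 2)%:E))%E).
    by rewrite lee_pmul2l// leeD.
  by rewrite -EFinD -EFinM lee_fin; lra.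
have e3 : (\int[sigma]_u (A u ^+ 2 + S u ^+ 2)%:E =
    \int[sigma]_u ((\sum_(x <- l) x.1 * cos (x.2 * u)) ^+ 2 +
                   (\sum_(x <- l) x.1 * sin (x.2 * u)) ^+ 2)%:E)%E.
  apply: eq_integral => u _; congr EFin; congr (_ ^+ 2 + _ ^+ 2).
    rewrite lE big_cons big_map big_enum /= mul1r /A -sumrN; congr (_ + _).
    by apply: eq_bigr => n _; rewrite mulNr.
  rewrite lE big_cons big_map big_enum /= mul1r /S -sumrN; congr (_ + _).
  by apply: eq_bigr => n _; rewrite mulNr.
rewrite gramE /Rintegral -e3 -lee_fin fineK// ge0_fin_numE.
  exact: le_lt_trans Ih (ltry _).
by apply: integral_ge0 => u _; rewrite lee_fin addr_ge0 ?sqr_ge0.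
Qed.

(** Density makes the defect small for a single exponential at some [N], hence
    at all later ones; sums of exponentials follow by induction. *)
Lemma cvg_bessel_defect l : bessel_defect l N @[N --> \oo] --> (0 : R).
Proof.
elim: l => [|x l IH].
  rewrite (_ : bessel_defect [::] = cst 0); first exact: cvg_cst.
  apply/funext => N; rewrite /bessel_defect /gram big_nil big1 ?subrr// => n _.
  by rewrite /spectral_coef big_nil expr0n.
have c1 t : bessel_defect [:: (1, t)] N @[N --> \oo] --> (0 : R).
  apply/cvgrPdist_le => e e0.
  have se0 : 0 < Num.sqrt e by rewrite sqrtr_gt0.
  have [N [c /gram_le_L2norm]] := lambda_dense t se0.
  move=> /(_ _ erefl); rewrite -cat1s gram_basis (sqr_sqrtr (ltW e0)) => ce.
  have {}ce : bessel_defect [:: (1, t)] N <= e.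
    by apply: le_trans ce; rewrite lerDl sumr_ge0// => n _; exact: sqr_ge0.
  near=> M; rewrite sub0r normrN ger0_norm ?bessel_defect_ge0//.
  apply: le_trans ce; apply: bessel_defect_nonincreasing.
  by near: M; exact: nbhs_infty_ge.
apply: (@squeeze_cvgr _ _ _ _ (cst 0)
  (fun N => 2 * (x.1 ^+ 2 * bessel_defect [:: (1, x.2)] N + bessel_defect l N))).
- by apply: nearW => N; rewrite bessel_defect_ge0 bessel_defect_cons.
- exact: cvg_cst.
rewrite (_ : 0 = 2 * (x.1 ^+ 2 * 0 + 0)); last by ring.
by apply: cvgMr; apply: cvgD => //; apply: cvgMr; exact: c1.
Unshelve. all: by end_near. Qed.

Lemma cvg_spectral_coef l :
  \sum_(n < N) spectral_coef l n ^+ 2 @[N --> \oo] --> gram l l.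
Proof.
rewrite (_ : (fun N => _) = fun N => gram l l - bessel_defect l N).
  by rewrite -[X in _ --> X]subr0; apply: cvgB; [exact: cvg_cst|exact: cvg_bessel_defect].
by apply/funext => N; rewrite /bessel_defect; ring.
Qed.

End symmetric_spectral_measure.

(** * Hermite sums under white noise *)

Section white_noise.
Context {R : realType}.

(** The pairing with [s] is continuous for the weak-* topology, hence Borel. *)
Lemma measurable_pairing (s : Schwartz R) :
  measurable_fun setT (fun w : Omega R => pairing w s).
Proof.
have cs : continuous (fun w : tempered R => pairing w s).
  move=> w; apply: (@continuous_comp _ _ _
    (@pairing R : tempered R -> {ptws Schwartz R -> R}) (fun f => f s)).
    exact: initial_continuous.
  exact: (@proj_continuous (Schwartz R) (fun=> R) s).
apply: (measurability _ (RGenOInfty.measurableE R)).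
move=> _ [_ [c ->] <-]; rewrite setTI; apply: sub_sigma_algebra.
apply: open_comp; first by move=> w _; exact: cs.
exact: interval_open.
Qed.

Lemma hermite_sum_pairing N (c : 'I_N -> R) (w : Omega R) :
  pairing w (\sum_(n < N) c n *: hermite R n) =
  \sum_(n < N) c n * hermite_rv n w.
Proof.
rewrite /pairing linear_sum; apply: eq_bigr => n _.
by rewrite linearZ.
Qed.

Lemma hermite_sum_fun N (c : 'I_N -> R) (x : R) :
  (\sum_(n < N) c n *: hermite R n : Schwartz R) x =
  \sum_(n < N) c n * hermite_fun n x.
Proof.
rewrite /Schwartz_fun raddf_sum /=.
by rewrite fct_sumE.
Qed.

Variable P : probability (Omega R) R.
Hypothesis P_white_noise : is_white_noise P.

Lemma characteristic_pairing (s : Schwartz R) (b : R) :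
  \int[P]_w cos (pairing w s + b) =
  cos b * expR (- (\int[lebesgue_measure]_x (s x ^+ 2)) / 2).
Proof.
have /= := P_white_noise s; rewrite /Cintegral /= => -[hc hs].
have mp := measurable_pairing s.
have ic : P.-integrable setT (EFin \o fun w => cos (pairing w s)).
  apply: (@bounded_integrable _ _ _ _ _ 1) => [|w]; last exact: cos_max.
  apply: measurableT_comp mp.
  exact: continuous_measurable_fun (@continuous_cos R).
have ins : P.-integrable setT (EFin \o fun w => sin (pairing w s)).
  apply: (@bounded_integrable _ _ _ _ _ 1) => [|w]; last exact: sin_max.
  apply: measurableT_comp mp.
  exact: continuous_measurable_fun (@continuous_sin R).
under eq_Rintegral do rewrite cosD (mulrC _ (cos b)) (mulrC _ (sin b)).
rewrite RintegralB//; [|exact: EFin_integrableZ..].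
rewrite !RintegralZl//.
have -> : \int[P]_w sin (pairing w s) = 0.
  rewrite -[LHS]opprK -[X in - X]mulN1r -RintegralZl// -[RHS]oppr0 -[in RHS]hs.
  by congr (- _); apply: eq_Rintegral => w _; rewrite sinN mulN1r.
rewrite mulr0 subr0 -hc; congr (_ * _).
by apply: eq_Rintegral => w _; rewrite cosN.
Qed.

(** The [Z_n] enter only through this formula: independence is contained in
    the additivity of the exponent. *)
Lemma characteristic_hermite_sum N (c : 'I_N -> R) (b : R) :
  \int[P]_w cos (\sum_(n < N) c n * hermite_rv n w + b) =
  cos b * expR (- (\sum_(n < N) c n ^+ 2) / 2).
Proof.
have := characteristic_pairing (\sum_(n < N) c n *: hermite R n) b.
have -> : \int[lebesgue_measure]_x
    ((\sum_(n < N) c n *: hermite R n : Schwartz R) x ^+ 2) = \sum_(n < N) c n ^+ 2.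
  rewrite -hermite_sum_norm.
  by apply: eq_Rintegral => x _; rewrite hermite_sum_fun.
move=> <-.
by apply: eq_Rintegral => w _; rewrite hermite_sum_pairing.
Qed.

Lemma measurable_hermite_sum N (c : 'I_N -> R) :
  measurable_fun setT (fun w : Omega R => \sum_(n < N) c n * hermite_rv n w).
Proof.
apply: measurable_sum => n; apply: measurable_funM => //.
exact: measurable_pairing.
Qed.

End white_noise.

Section square_integrals.
Context {R : realType} d (T : measurableType d) (P : probability T R).

Definition sqint (f : T -> R) : \bar R := (\int[P]_w ((f w) ^+ 2)%:E)%E.

Implicit Types f g : T -> R.

Lemma sqint_ge0 f : (0 <= sqint f)%E.
Proof. by apply: integral_ge0 => w _; rewrite lee_fin sqr_ge0. Qed.

(** Extended-real valued, so that no finiteness has to be known beforehand. *)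
Lemma sqintZD (c : R) f g : measurable_fun setT f -> measurable_fun setT g ->
  (sqint (fun w => c * f w + g w)%R <=
     (2 * c ^+ 2)%:E * sqint f + 2%:E * sqint g)%E.
Proof.
move=> mf mg; have mf2 := measurable_funX 2 mf; have mg2 := measurable_funX 2 mg.
have c0 : 0 <= 2 * c ^+ 2 by rewrite mulr_ge0 ?sqr_ge0.
rewrite /sqint -!ge0_integralZl//; first last.
- by move=> w _; rewrite lee_fin sqr_ge0.
- exact/measurable_EFinP.
- by move=> w _; rewrite lee_fin sqr_ge0.
- exact/measurable_EFinP.
rewrite -ge0_integralD//; first last.
- by apply/measurable_EFinP; exact: measurable_funM.
- by move=> w _; rewrite -EFinM lee_fin mulr_ge0 ?sqr_ge0.
- by apply/measurable_EFinP; exact: measurable_funM.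
- by move=> w _; rewrite -EFinM lee_fin mulr_ge0 ?sqr_ge0.
apply: ge0_le_integral => //.
- by move=> w _; rewrite lee_fin sqr_ge0.
- apply/measurable_EFinP; apply: measurable_funX; apply: measurable_funD => //.
  exact: measurable_funM.
- apply/measurable_EFinP; apply: measurable_funD; exact: measurable_funM.
- move=> w _; rewrite -!EFinM -EFinD lee_fin.
  have := sqr_ge0 (c * f w - g w); nra.
Qed.

Lemma cvg_sqintZD (c : R) (u v : nat -> T -> R) :
  (forall n, measurable_fun setT (u n)) -> (forall n, measurable_fun setT (v n)) ->
  sqint (u n) @[n --> \oo] --> 0%E -> sqint (v n) @[n --> \oo] --> 0%E ->
  sqint (fun w => c * u n w + v n w) @[n --> \oo] --> 0%E.
Proof.
move=> mu mv cu cv.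
apply: (@squeeze_cvge _ _ _ _ (cst 0%E) _
  (fun n => (2 * c ^+ 2)%:E * sqint (u n) + 2%:E * sqint (v n))%E).
- by apply: nearW => n; rewrite sqint_ge0/=; exact: sqintZD.
- exact: cvg_cst.
rewrite (_ : 0%E = (2 * c ^+ 2)%:E * 0 + 2%:E * 0)%E; last by rewrite !mule0 adde0.
by apply: cvgeD; [rewrite !mule0| apply: cvgeZl..].
Qed.

Lemma sqint_fin_integrable f : measurable_fun setT f -> (sqint f < +oo)%E ->
  P.-integrable setT (fun w => (f w ^+ 2)%:E).
Proof.
move=> mf hf; apply/integrableP; split.
  exact/measurable_EFinP/measurable_funX.
by under eq_integral do rewrite gee0_abs ?lee_fin ?sqr_ge0//.
Qed.

End square_integrals.

(** * The stationary process *)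

Section spectral_process.
Context {R : realType} (sigma : probability (measurableTypeR R) R).
Hypothesis sigma_sym : forall A : set (measurableTypeR R),
  measurable A -> sigma [set u | A (- u)] = sigma A.
Variable lambda : nat -> R.
Hypothesis lambda_basis :
  L2_orthonormal_basis sigma (fun n u => expi (lambda n * u)).
Variable P : probability (Omega R) R.
Hypothesis P_white_noise : is_white_noise P.
Variable W : R -> Omega R -> R[i].
Hypothesis W_process : is_W_process P sigma lambda W.

Local Notation K := (spectral_cov sigma).

Lemma lambda_orthonormal i j : K (lambda i - lambda j) = (i == j)%:R.
Proof.
have [_ /(_ i j) + _] := lambda_basis.
move=> /(congr1 (@complex.Re R)); rewrite /L2_inner /Cintegral.
have -> : complex.Re ((i == j)%:R : R[i]) = (i == j)%:R by case: (i == j).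
move=> <-; apply: eq_Rintegral => u _.
by rewrite mulrBl cosB /= mulrN opprK.
Qed.

Lemma lambda_dense (t e : R) : 0 < e -> exists N (c : 'I_N -> R[i]),
  (L2norm sigma (fun u =>
    (expi (t * u) - \sum_(n < N) c n * expi (lambda n * u))%R) < e%:E)%E.
Proof.
move=> e0; have [_ _ H] := lambda_basis; apply: H e0; split => /=.
- exact: measurable_cosM.
- exact: measurable_sinM.
rewrite L2normE /=; apply: poweR_lty.
rewrite (eq_integral (cst 1%E)) => [|u _]; last by rewrite /= cos2Dsin2.
by rewrite integral_cst// mul1e -ge0_fin_numE// fin_num_measure.
Qed.

Implicit Types l : seq ((R * R) * R).

(** The linear combinations of all real and imaginary parts of [W], so that one
    characteristic function covers the joint laws of the complex-valued process;
    an entry [((a, b), t)] of the list contributes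
    [a Re(W(t)) + b Im(W(t))]. *)
Definition real_combination l (w : Omega R) : R :=
  \sum_(x <- l) (x.1.1 * complex.Re (W x.2 w) + x.1.2 * complex.Im (W x.2 w)).

(** The imaginary parts of the partial sums vanish, so only the coefficients of
    the real parts survive in the limit. *)
Definition re_part l : seq (R * R) := [seq (x.1.1, x.2) | x <- l].

Definition hermite_combination l N (w : Omega R) : R :=
  \sum_(n < N) spectral_coef sigma lambda (re_part l) n * hermite_rv n w.

Lemma measurable_ReW t : measurable_fun setT (fun w => complex.Re (W t w)).
Proof. by have [[]] := W_process t. Qed.

Lemma measurable_ImW t : measurable_fun setT (fun w => complex.Im (W t w)).
Proof. by have [[]] := W_process t. Qed.

Lemma measurable_real_combination l : measurable_fun setT (real_combination l).
Proof.
apply: measurable_sum => x; apply: measurable_funD; apply: measurable_funM => //.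
  exact: measurable_ReW.
exact: measurable_ImW.
Qed.

Lemma measurable_hermite_combination l N :
  measurable_fun setT (hermite_combination l N).
Proof. exact: measurable_hermite_sum. Qed.

Lemma W_partial_sum t N (w : Omega R) :
  \sum_(n < N) fourier sigma (t - lambda n) * Complex (hermite_rv n w) 0 =
  Complex (hermite_combination [:: ((1, 0), t)] N w) 0.
Proof.
rewrite /hermite_combination; elim/big_ind2: _ => // [x _ y _ -> ->|n _].
  by apply/eqP; rewrite eq_complex /= addr0 !eqxx.
rewrite fourier_real// /spectral_coef /= big_seq1 mul1r.
by apply/eqP; rewrite eq_complex /= !mulr0 !mul0r subr0 addr0 !eqxx.
Qed.

(** The squared distance of the partial sums to [W t] splits into its real part
    and the constant [E (Im (W t))^2], so both limits vanish. *)
Lemma cvg_W_parts t :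
  sqint P (fun w => hermite_combination [:: ((1, 0), t)] N w -
                    complex.Re (W t w)) @[N --> \oo] --> 0%E /\
  sqint P (fun w => complex.Im (W t w)) = 0%E.
Proof.
have [_ /cvg_L2norm_integral cW] := W_process t.
have mS N : measurable_fun setT (fun w =>
    hermite_combination [:: ((1, 0), t)] N w - complex.Re (W t w)).
  apply: measurable_funB; last exact: measurable_ReW.
  exact: measurable_hermite_combination.
have e N : (\int[P]_w (complex.Re (\sum_(n < N) fourier sigma (t - lambda n) *
      Complex (hermite_rv n w) 0 - W t w) ^+ 2 +
    complex.Im (\sum_(n < N) fourier sigma (t - lambda n) *
      Complex (hermite_rv n w) 0 - W t w) ^+ 2)%:E)%E =
    (sqint P (fun w => hermite_combination [:: ((1, 0), t)] N w -
                    complex.Re (W t w))%R +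
    sqint P (fun w => complex.Im (W t w)))%E.
  rewrite /sqint -ge0_integralD//; first last.
  - apply/measurable_EFinP; apply: measurable_funX; exact: measurable_ImW.
  - by move=> w _; rewrite lee_fin sqr_ge0.
  - by apply/measurable_EFinP; exact: measurable_funX.
  - by move=> w _; rewrite lee_fin sqr_ge0.
  apply: eq_integral => w _; rewrite -EFinD W_partial_sum !raddfB /=.
  by rewrite sub0r sqrrN.
move: cW; rewrite (funext e) => cW {e}.
split.
  apply: (@squeeze_cvge _ _ _ _ (cst 0%E) _ _ _ _ _ cW); last exact: cvg_cst.
  by apply: nearW => N; rewrite sqint_ge0/= leeDl// sqint_ge0.
apply/eqP; rewrite eq_le sqint_ge0 andbT -(cvg_lim _ cW)//.
apply: lime_ge; first by apply/cvg_ex; exists 0%E.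
by apply: nearW => N; rewrite leeDr// sqint_ge0.
Qed.

Lemma cvg_hermite_combination l :
  sqint P (fun w => hermite_combination l N w - real_combination l w)
    @[N --> \oo] --> 0%E.
Proof.
elim: l => [|x l IH].
  rewrite (_ : (fun N => _) = cst 0%E); first exact: cvg_cst.
  apply/funext => N; rewrite /sqint (eq_integral (cst 0%E)) ?integral0// => w _.
  rewrite /real_combination big_nil /hermite_combination big1 ?subr0 ?expr0n//.
  by move=> n _; rewrite /spectral_coef big_nil mul0r.
have [cR cI] := cvg_W_parts x.2.
have mS N : measurable_fun setT (fun w =>
    hermite_combination [:: ((1, 0), x.2)] N w - complex.Re (W x.2 w)).
  apply: measurable_funB; last exact: measurable_ReW.
  exact: measurable_hermite_combination.
have ml N : measurable_fun setT (fun w =>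
    hermite_combination l N w - real_combination l w).
  apply: measurable_funB; first exact: measurable_hermite_combination.
  exact: measurable_real_combination.
have cI0 : sqint P (fun w => complex.Im (W x.2 w)) @[_ --> \oo] --> 0%E.
  by rewrite cI; exact: cvg_cst.
have cIl := cvg_sqintZD (- x.1.2) (fun=> measurable_ImW x.2) ml cI0 IH.
have mIl N : measurable_fun setT (fun w => - x.1.2 * complex.Im (W x.2 w) +
    (hermite_combination l N w - real_combination l w)).
  apply: measurable_funD => //; apply: measurable_funM => //.
  exact: measurable_ImW.
have := cvg_sqintZD x.1.1 mS mIl cR cIl.
rewrite [X in X @ _ --> _ -> _](_ : _ = fun N => sqint P (fun w =>
  hermite_combination (x :: l) N w - real_combination (x :: l) w))//.
apply/funext => N; congr (sqint P); apply/funext => w.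
rewrite /real_combination big_cons -/(real_combination l w).
have -> : hermite_combination (x :: l) N w =
    x.1.1 * hermite_combination [:: ((1, 0), x.2)] N w + hermite_combination l N w.
  rewrite /hermite_combination mulr_sumr -big_split /=; apply: eq_bigr => n _.
  by rewrite /spectral_coef big_cons big_seq1 /= mul1r mulrA mulrDl.
by ring.
Qed.

Lemma characteristic_W l (b : R) :
  \int[P]_w cos (real_combination l w + b) =
  cos b * expR (- gram sigma (re_part l) (re_part l) / 2).
Proof.
apply: (@characteristic_L2_limit _ _ _ P (hermite_combination l)).
- exact: measurable_hermite_combination.
- exact: measurable_real_combination.
- exact: cvg_hermite_combination.
rewrite (_ : (fun N => _) = fun N => cos b * expR (- (\sum_(n < N)
  spectral_coef sigma lambda (re_part l) n ^+ 2) / 2)); last first.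
  by apply/funext => N; exact: characteristic_hermite_sum.
apply: cvgMr; apply: continuous_cvg; first exact: continuous_expR.
apply: cvgMl; apply: cvgN.
by apply: cvg_spectral_coef => //; [exact: lambda_orthonormal|exact: lambda_dense].
Qed.

Lemma gram_scale (c : R) l :
  gram sigma (re_part [seq ((c * x.1.1, c * x.1.2), x.2) | x <- l])
             (re_part [seq ((c * x.1.1, c * x.1.2), x.2) | x <- l]) =
  c ^+ 2 * gram sigma (re_part l) (re_part l).
Proof.
rewrite /gram /re_part !big_map mulr_sumr; apply: eq_bigr => x _.
by rewrite !big_map mulr_sumr; apply: eq_bigr => y _ /=; ring.
Qed.

Lemma sqint_real_combination_lty l : (sqint P (real_combination l) < +oo)%E.
Proof.
elim: l => [|x l IH].
  rewrite /sqint (eq_integral (cst 0%E)) ?integral0// => w _.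
  by rewrite /real_combination big_nil expr0n.
have WL t : (sqint P (fun w => complex.Re (W t w)) < +oo)%E /\
            (sqint P (fun w => complex.Im (W t w)) < +oo)%E.
  have [[mR mI] fW _] := W_process t.
  have IW : (\int[P]_w (complex.Re (W t w) ^+ 2 + complex.Im (W t w) ^+ 2)%:E < +oo)%E.
    by move: fW; rewrite L2normE => /lty_poweRy; apply; rewrite invr_eq0.
  have le (f : Omega R -> R) : measurable_fun setT f ->
      (forall w, f w ^+ 2 <= complex.Re (W t w) ^+ 2 + complex.Im (W t w) ^+ 2) ->
      (sqint P f < +oo)%E.
    move=> mf fle; apply: le_lt_trans IW; apply: ge0_le_integral => //.
    - by move=> w _; rewrite lee_fin sqr_ge0.
    - exact/measurable_EFinP/measurable_funX.
    - by apply/measurable_EFinP; apply: measurable_funD; exact: measurable_funX.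
    - by move=> w _; rewrite lee_fin.
  by split; apply: le => // w; rewrite ?lerDl ?lerDr sqr_ge0.
have [WR WI] := WL x.2.
have fin (f g : Omega R -> R) c : measurable_fun setT f -> measurable_fun setT g ->
    (sqint P f < +oo -> sqint P g < +oo -> sqint P (fun w => c * f w + g w)%R < +oo)%E.
  move=> mf mg If Ig; apply: le_lt_trans (sqintZD P c mf mg) _.
  by rewrite lte_add_pinfty// lte_mul_pinfty// lee_fin mulr_ge0 ?sqr_ge0.
have mR := measurable_ReW x.2; have mI := measurable_ImW x.2.
have ml := measurable_real_combination l.
have h1 := fin _ _ x.1.2 mI ml WI IH.
have h2 := fin _ _ x.1.1 mR _ WR h1.
have {}h2 := h2 (measurable_funD (measurable_funM (measurable_cst _) mI) ml).
apply: le_lt_trans h2; rewrite le_eqVlt; apply/orP; left; apply/eqP.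
congr (sqint P); apply/funext => w.
by rewrite /real_combination big_cons addrA.
Qed.

(** The characteristic function of [c f] at [1] is that of [f] at [c], so the
    whole function of [c] is known from the scaled lists. *)
Lemma sqint_real_combination l :
  sqint P (real_combination l) = (gram sigma (re_part l) (re_part l))%:E.
Proof.
have ml := measurable_real_combination l.
have il := sqint_fin_integrable ml (sqint_real_combination_lty l).
rewrite /sqint -[LHS]fineK; last exact: integrable_fin_num il.
congr EFin; apply: (second_moment_of_characteristic _ ml il); first exact: gram_ge0.
move=> t; have := characteristic_W [seq ((t * x.1.1, t * x.1.2), x.2) | x <- l] 0.
rewrite gram_scale cos0 mul1r mulNr => <-; apply: eq_Rintegral => w _.
rewrite addr0 /real_combination big_map mulr_sumr; congr cos.
by apply: eq_bigr => x _ /=; ring.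
Qed.

Lemma sqint_ReW t : sqint P (fun w => complex.Re (W t w)) = 1%E.
Proof.
have := sqint_real_combination [:: ((1, 0), t)].
rewrite /gram /= !big_seq1 /= subrr spectral_cov0 !mul1r => <-.
congr (sqint P); apply/funext => w.
by rewrite /real_combination big_seq1 /= mul1r mul0r addr0.
Qed.

Lemma sqint_ReW_sub s t :
  sqint P (fun w => complex.Re (W s w - W t w)) = (2 * (1 - K (s - t)))%:E.
Proof.
have := sqint_real_combination [:: ((1, 0), s); ((- 1, 0), t)].
have -> : gram sigma (re_part [:: ((1, 0), s); ((- 1, 0), t)])
    (re_part [:: ((1, 0), s); ((- 1, 0), t)]) = 2 * (1 - K (s - t)).
  rewrite /gram /= !big_cons !big_nil /= !subrr spectral_cov0.
  by rewrite -[t - s]opprB spectral_covN; ring.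
move=> <-; congr (sqint P); apply/funext => w; rewrite raddfB.
by rewrite /real_combination !big_cons big_nil /=; ring.
Qed.

Lemma sqint_ImW_sub s t : sqint P (fun w => complex.Im (W s w - W t w)) = 0%E.
Proof.
have := sqint_real_combination [:: ((0, 1), s); ((0, - 1), t)].
have -> : gram sigma (re_part [:: ((0, 1), s); ((0, - 1), t)])
    (re_part [:: ((0, 1), s); ((0, - 1), t)]) = 0.
  by rewrite /gram /= !big_cons !big_nil /=; ring.
move=> h; apply: etrans h; congr (sqint P); apply/funext => w; rewrite raddfB.
by rewrite /real_combination !big_cons big_nil /=; ring.
Qed.

Lemma integral_Re_Im (f : Omega R -> R[i]) :
  measurable_fun setT (fun w => complex.Re (f w)) ->
  measurable_fun setT (fun w => complex.Im (f w)) ->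
  (\int[P]_w (complex.Re (f w) ^+ 2 + complex.Im (f w) ^+ 2)%:E =
   sqint P (fun w => complex.Re (f w)) + sqint P (fun w => complex.Im (f w)))%E.
Proof.
move=> mR mI; rewrite /sqint -ge0_integralD//.
- by move=> w _; rewrite lee_fin sqr_ge0.
- exact/measurable_EFinP/measurable_funX.
- by move=> w _; rewrite lee_fin sqr_ge0.
- exact/measurable_EFinP/measurable_funX.
Qed.

Lemma W_unit_variance t : ('E_P[fun w => (Normc.normc (W t w) ^+ 2)%R] = 1)%E.
Proof.
rewrite unlock; under eq_integral do rewrite normc_sqr.
rewrite integral_Re_Im; [|exact: measurable_ReW|exact: measurable_ImW].
by rewrite sqint_ReW (cvg_W_parts t).2 adde0.
Qed.

Lemma L2norm_W_sub s t :
  L2norm P (fun w => W s w - W t w) = (Num.sqrt (2 * (1 - K (s - t))))%:E.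
Proof.
rewrite L2normE integral_Re_Im.
- rewrite sqint_ReW_sub sqint_ImW_sub adde0 poweR_EFin powR12_sqrt//.
  by rewrite -lee_fin -sqint_ReW_sub sqint_ge0.
- under eq_fun do rewrite raddfB; apply: measurable_funB; exact: measurable_ReW.
- under eq_fun do rewrite raddfB; apply: measurable_funB; exact: measurable_ImW.
Qed.

Lemma W_stationary : stationary P W.
Proof.
move=> k t h A mA.
have mm (s : k.-tuple R) : measurable_fun setT (marginal W s).
  apply/measurable_fun_tnthP => i; rewrite (_ : _ \o _ =
    fun w => (complex.Re (W (tnth s i) w), complex.Im (W (tnth s i) w))).
    by apply: measurable_fun_pair; [exact: measurable_ReW|exact: measurable_ImW].
  by apply/funext => w; rewrite /marginal /= tnth_mktuple.
apply: (@equal_characteristic_equal_law _ _ _ P _ _ _ (@pair_coord R k)) => //.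
- exact: measurable_pair_coord.
- move=> a b.
  pose l (s : k.-tuple R) :=
    [seq ((a (i, false), a (i, true)), tnth s i) | i <- enum 'I_k].
  have e (s : k.-tuple R) : \int[P]_w cos
      (\sum_i a i * pair_coord i (marginal W s w) + b) =
      cos b * expR (- gram sigma (re_part (l s)) (re_part (l s)) / 2).
    rewrite -characteristic_W; apply: eq_Rintegral => w _; congr (cos (_ + _)).
    rewrite /real_combination big_map big_enum /=.
    rewrite (eq_bigr (fun p => a (p.1, p.2) *
      pair_coord (p.1, p.2) (marginal W s w))); last by case.
    rewrite -(pair_bigA _ (fun i c => a (i, c) * pair_coord (i, c) (marginal W s w))) /=.
    apply: eq_bigr => i _; rewrite big_bool /= addrC /pair_coord /=.
    by rewrite /marginal tnth_mktuple.
  have shift : gram sigma (re_part (l [tuple tnth t i + h | i < k]))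
      (re_part (l [tuple tnth t i + h | i < k])) =
      gram sigma (re_part (l t)) (re_part (l t)).
    rewrite /gram /re_part !big_map; apply: eq_bigr => i _.
    rewrite !big_map; apply: eq_bigr => j _ /=; rewrite !tnth_mktuple.
    by rewrite opprD addrACA subrr addr0.
  by rewrite !e shift.
- exact: measurable_tuple_rays.
Qed.

Hypothesis sigma_supp : sigma (~` [set u | - 2^-1 <= u <= 2^-1]) = 0%E.

(** [1 - cos(s u) <= s^2] on the support, and [1 - cos <= 2] on its complement,
    which is negligible. *)
Lemma onem_spectral_cov_le s : 1 - K s <= s ^+ 2.
Proof.
pose A : set (measurableTypeR R) := [set u | - 2^-1 <= u <= 2^-1].
have mA : measurable A.
  rewrite (_ : A = `[- 2^-1, 2^-1]%classic); first exact: measurable_itv.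
  by apply/seteqP; split => u; rewrite /A /= in_itv.
have i1 : sigma.-integrable setT (EFin \o cst 1).
  by apply: (@bounded_integrable _ _ _ _ _ 1) => // u; rewrite normr1.
have ic := integrable_cosM sigma s.
have iA : sigma.-integrable setT (EFin \o (\1_(~` A) : measurableTypeR R -> R)).
  apply: (@bounded_integrable _ _ _ _ _ 1) => [|u].
    exact/measurable_indic/measurableC.
  by rewrite indicE; case: (_ \in _); rewrite ?normr1 ?normr0.
have ic2 : sigma.-integrable setT (EFin \o cst (s ^+ 2)).
  by apply: (@bounded_integrable _ _ _ _ _ (s ^+ 2)) => // u; rewrite ger0_norm ?sqr_ge0.
have e1 : 1 - K s = \int[sigma]_u (1 - cos (s * u)).
  by rewrite RintegralB// Rintegral_probability_cst.
have e2 : s ^+ 2 = \int[sigma]_u (s ^+ 2 + 2 * \1_(~` A) u).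
  rewrite RintegralD//; last exact: EFin_integrableZ.
  rewrite Rintegral_probability_cst RintegralZl//.
  rewrite /Rintegral (integral_indic _ measurableT (measurableC mA)) setIT.
  rewrite -[LHS]addr0 -[X in _ + X](mulr0 2); congr (_ + 2 * _).
  by transitivity (fine (0%:E : \bar R)); last by congr fine; exact/esym.
rewrite e1 e2; apply: le_Rintegral => //.
- exact: EFin_integrableB.
- by apply: EFin_integrableD => //; exact: EFin_integrableZ.
move=> u _; have [Au|nAu] := pselect (A u).
  rewrite indicE memNset ?mulr0 ?addr0; last by move=> /(_ Au).
  rewrite (le_trans (onemcos_le _))// exprMn.
  have u1 : u ^+ 2 <= 1 by move: Au => /= /andP[? ?]; nra.
  have := sqr_ge0 s; nra.
rewrite indicE mem_set// mulr1; have := cos_geN1 (s * u); have := sqr_ge0 s; lra.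
Qed.

Lemma W_L2_continuous : L2_continuous P W.
Proof.
move=> t; under eq_cvg do rewrite L2norm_W_sub.
apply/fine_cvgP; split; first exact: nearW.
apply/cvgrPdist_le => e e0; near=> s; rewrite sub0r normrN /= ger0_norm//.
have st : `|t - s| <= e / 2.
  near: s; apply: cvgr_dist_le; [exact: cvg_id|by rewrite divr_gt0].
have -> : e = Num.sqrt (e ^+ 2) by rewrite sqrtr_sqr gtr0_norm.
apply: ler_wsqrtr; have := onem_spectral_cov_le (s - t).
rewrite -(real_normK (num_real (s - t))) distrC.
have := normr_ge0 (t - s); nra.
Unshelve. all: by end_near. Qed.

End spectral_process.

Unset Implicit Arguments.

Theorem theorem6p4 (R : realType)
    (sigma : probability (measurableTypeR R) R)
    (sigma_sym : forall A : set (measurableTypeR R),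
       measurable A -> sigma [set u | A (- u)] = sigma A)
    (sigma_supp : sigma (~` [set u | - 2^-1 <= u <= 2^-1]) = 0%E)
    (lambda : nat -> R)
    (lambda0 : lambda 0%N = 0)
    (lambda_inj : injective lambda)
    (lambda_pi : forall n, exists k : nat, lambda n = pi * k%:R)
    (lambda_basis :
       L2_orthonormal_basis sigma (fun n u => expi (lambda n * u)))
    (P : probability (Omega R) R)
    (P_white_noise : is_white_noise P)
    (W : R -> Omega R -> R[i])
    (W_process : is_W_process P sigma lambda W) :
  [/\ L2_continuous P W,
      stationary P W &
      forall t, ('E_P[fun w => (Normc.normc (W t w) ^+ 2)%R] = 1)%E].
Proof.
split.
- exact: (W_L2_continuous sigma_sym lambda_basis P_white_noise W_process sigma_supp).
- exact: (W_stationary sigma_sym lambda_basis P_white_noise W_process).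
- exact: (W_unit_variance sigma_sym lambda_basis P_white_noise W_process).
Qed.
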